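(* There exists a compact connected linearly ordered topological space $X$ such that $H_+(X)=H(X)$ and this topological group (with the compact-open topology) is isomorphic, as a topological group, to the discrete group of integers $\mathbb{Z}$.
   Context: A linearly ordered topological space is a set with a linear order equipped with the order (interval) topology. For a compact such $X$, $H(X)$ is the group of all homeomorphisms $X\to X$ with the compact-open topology, and $H_+(X)$ is the subgroup of order-preserving homeomorphisms with the subspace topology. *)

(* Defs.v *)
From HB Require Import structures.
From mathcomp Require Import all_boot all_order all_algebra.
From mathcomp Require Import all_classical topology.

Set Implicit Arguments.
Unset Strict Implicit.
Unset Printing Implicit Defensive.

Import Order.TTheory.

Local Open Scope classical_set_scope.

Definition homeomorphism {T U : topologicalType} (f : T -> U) : Prop :=
  continuous f /\
  exists g : U -> T, [/\ continuous g, cancel f g & cancel g f].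

(* The set of homeomorphisms of [X], as a subset of the function space with the
   compact-open topology; the sigma type inherits the subspace topology. *)
Definition homeo_set (X : topologicalType) : set {compact-open, X -> X} :=
  [set f : X -> X | homeomorphism f].

Definition homeo (X : topologicalType) : Type := set_type (@homeo_set X).

HB.instance Definition _ (X : topologicalType) :=
  Topological.copy (homeo X) (set_type (@homeo_set X)).

Definition homeo_fun (X : topologicalType) (h : homeo X) : X -> X :=
  set_val h.
Coercion homeo_fun : homeo >-> Funclass.

Section HomeoGroup.
Context {X : topologicalType}.
Implicit Types h k : homeo X.

Definition mk_homeo (f : X -> X) (hf : homeomorphism f) : homeo X :=
  exist (fun g => g \in @homeo_set X) f (mem_set hf).

Lemma homeoP h : homeomorphism h.
Proof. exact: set_valP. Qed.

Lemma homeo_ext h k : h =1 k -> h = k.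
Proof. by move=> hk; apply: val_inj; apply/funext. Qed.

Lemma homeomorphism_id : homeomorphism (@id X).
Proof. by split=> [x //|]; exists id; split=> // x. Qed.

Lemma homeomorphism_comp h k : homeomorphism (h \o k).
Proof.
have [ch [h' [ch' hK h'K]]] := homeoP h.
have [ck [k' [ck' kK k'K]]] := homeoP k.
split; first by move=> x; apply: continuous_comp; [exact: ck | exact: ch].
exists (k' \o h'); split; last 2 first.
- by move=> x; rewrite /= hK kK.
- by move=> x; rewrite /= k'K h'K.
by move=> x; apply: continuous_comp; [exact: ch' | exact: ck'].
Qed.

Lemma homeo_inverse_subproof h :
  exists g : X -> X, [/\ homeomorphism g, cancel h g & cancel g h].
Proof.
have [ch [g [cg hK gK]]] := homeoP h.
by exists g; split=> //; split=> //; exists h.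
Qed.

Definition homeo_inv_fun h : X -> X := projT1 (cid (homeo_inverse_subproof h)).

Lemma homeo_inv_funP h : [/\ homeomorphism (homeo_inv_fun h),
  cancel h (homeo_inv_fun h) & cancel (homeo_inv_fun h) h].
Proof. exact: (projT2 (cid (homeo_inverse_subproof h))). Qed.

Definition homeo_one : homeo X := mk_homeo homeomorphism_id.
Definition homeo_mul h k : homeo X := mk_homeo (homeomorphism_comp h k).
Definition homeo_inv h : homeo X :=
  mk_homeo (let: And3 hg _ _ := homeo_inv_funP h in hg).

Lemma homeo_mulA : associative homeo_mul.
Proof. by move=> f g h; apply: homeo_ext. Qed.

Lemma homeo_mul1 : left_id homeo_one homeo_mul.
Proof. by move=> f; apply: homeo_ext. Qed.

Lemma homeo_mulr1 : right_id homeo_one homeo_mul.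
Proof. by move=> f; apply: homeo_ext. Qed.

Lemma homeo_mulV : left_inverse homeo_one homeo_inv homeo_mul.
Proof.
move=> h; apply: homeo_ext => x.
by have [_ hK _] := homeo_inv_funP h; exact: hK.
Qed.

Lemma homeo_mulrV : right_inverse homeo_one homeo_inv homeo_mul.
Proof.
move=> h; apply: homeo_ext => x.
by have [_ _ hK] := homeo_inv_funP h; exact: hK.
Qed.

HB.instance Definition _ := isGroup.Build (homeo X)
  homeo_mulA homeo_mul1 homeo_mulr1 homeo_mulV homeo_mulrV.

End HomeoGroup.

Definition homeo_plus {d : Order.disp_t} (X : orderTopologicalType d) :
    set (homeo X) :=
  [set h | {homo h : x y / (x <= y)%O}].
Arguments homeo_plus {d} X.

(* The two structures need not be compatible; compatibility is the predicate
   [is_topological_group] below. *)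
#[short(type="topologizedGroupType")]
HB.structure Definition TopologizedGroup :=
  {G of Group G & Topological G}.

HB.instance Definition _ (X : topologicalType) := Topological.on (homeo X).

Definition is_topological_group (G : topologizedGroupType) : Prop :=
  continuous (fun xy : G * G => (xy.1 * xy.2)%g) /\
  continuous (fun x : G => (x^-1)%g).

Section HomeoTopology.
Context {X : topologicalType}.

Lemma homeo_cvgP (T : topologicalType) (F : T -> homeo X) (z : T) :
  (forall K O : set X, compact K -> open O -> F z @` K `<=` O ->
    nbhs z [set w | F w @` K `<=` O]) ->
  {for z, continuous F}.
Proof.
move=> HF.
have H : (set_val \o F : T -> {compact-open, X -> X}) @ z
    --> (set_val (F z) : {compact-open, X -> X}).
  by apply/compact_open_cvgP => K O cK oO; exact: HF.
move=> U [?/= [[W oW <-]]] /= Wz /filterS; apply; apply: H.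
exact: open_nbhs_nbhs.
Qed.

Lemma homeo_nbhs (h : homeo X) (K O : set X) : compact K -> open O ->
  h @` K `<=` O -> nbhs h [set k : homeo X | k @` K `<=` O].
Proof.
move=> cK oO hKO; apply: open_nbhs_nbhs; split=> //.
by exists [set g | g @` K `<=` O]; first exact: compact_open_open.
Qed.

Lemma homeo_topological_group : compact [set: X] -> hausdorff_space X ->
  is_topological_group (homeo X).
Proof.
move=> cX hX; split.
  suff mul_cts (h k : homeo X) : {for (h, k),
      continuous (fun xy : homeo X * homeo X => (xy.1 * xy.2)%g)}.
    by move=> [h k]; exact: mul_cts.
  apply: homeo_cvgP => K O cK oO hkKO.
  have ch := (homeoP h).1; have ck := (homeoP k).1.
  have ckK : compact (k @` K).
    by apply: continuous_compact => //; exact: continuous_subspaceT.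
  have clkK : closed (k @` K) by exact: compact_closed.
  have ohO : open (h @^-1` O) by exact: open_comp.
  have kKhO : k @` K `<=` h @^-1` O.
    by move=> _ [x Kx <-]; apply: hkKO; exists x.
  have [V /set_nbhsP[W [oW kKW WV]] VhO] :
      filter_from (set_nbhs (k @` K)) closure (h @^-1` O).
    by apply: (compact_normal hX cX clkK); apply/set_nbhsP; exists (h @^-1` O);
      split.
  have cV : compact (closure V).
    exact: (subclosed_compact (@closed_closure _ _) cX).
  exists ([set h' : homeo X | h' @` closure V `<=` O],
          [set k' : homeo X | k' @` K `<=` W]) => /=.
    split; apply: homeo_nbhs => //.
    by move=> _ [x Vx <-]; exact: VhO.
  move=> [h' k'] [/= h'V k'K] _ [x Kx <-].
  apply: h'V; exists (k' x) => //.
  by apply: subset_closure; apply: WV; apply: k'K; exists x.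
move=> h; apply: homeo_cvgP => K O cK oO hKO.
have VE (k : homeo X) :
    ((k^-1)%g : homeo X) @` K `<=` O <-> k @` (~` O) `<=` ~` K.
  have [_ kK kVK] := homeo_inv_funP k; split=> kKO.
    move=> _ [x nOx <-] Kx; apply: nOx; apply: kKO.
    by exists (k x) => //; exact: kK.
  move=> _ [x Kx <-]; apply: contrapT => nO.
  apply: (kKO x) => //; exists (((k^-1)%g : homeo X) x) => //; exact: kVK.
have -> : [set k : homeo X | ((k^-1)%g : homeo X) @` K `<=` O] =
    [set k : homeo X | k @` (~` O) `<=` ~` K].
  by apply/seteqP; split=> k /= /VE.
apply: homeo_nbhs; last exact/VE.
  apply: (subclosed_compact _ cX) => //; exact: open_closedC.
by apply: closed_openC; exact: compact_closed.
Qed.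

End HomeoTopology.

Definition topological_group_isomorphic (G H : topologizedGroupType) : Prop :=
  exists f : G -> H, homeomorphism f /\ {morph f : x y / (x * y)%g}.

(* The additive group of the integers, written multiplicatively as required
   by [groupType], with the discrete topology. *)
Definition discrete_int : Type := int.

HB.instance Definition _ :=
  Group.copy discrete_int (Algebra.to_multiplicative int).
HB.instance Definition _ :=
  DiscreteTopology.copy discrete_int (discrete_topology int).

Lemma discrete_intM (m n : discrete_int) :
  (m * n)%g = ((m : int) + (n : int))%R :> discrete_int.
Proof. by []. Qed.

(* Main.v *)
(**
A word is a pair of an integer and a finite sequence of letters, the [k]-th
letter being taken in a well-ordered alphabet of regular type [kappa_k], where
the [kappa_k] are distinct and uncountable. Words are ordered by the integer
first, and then by a lexicographic order whose direction is reversed at every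
odd position, as for continued fractions. The words form a dense linear order,
and its Dedekind completion is a compact connected ordered space [X].

Because of the alternation, a word of length [m] has cofinalities [kappa_m] and
[kappa_(m+1)] on its two sides, the even one on the left and the odd one on the
right. No other point of [X] has two-sided cofinalities [kappa_k],
[kappa_(k+1)]: such a point either lies in a nested sequence of cylinders, and
has countable cofinalities, or is the limit of fewer than [kappa_n] children of
a word of length [n], so that one of its cofinalities is too small. A
homeomorphism of [X] is monotone by the intermediate value theorem. It cannot
exchange left and right, since the parities would not match; hence it is
increasing and preserves the length of words. On the words of length 0 it is a
translation of the integers; after composition with the inverse translation, it
fixes all words by induction on the length, since a well-order has no
nontrivial automorphism.
*)
From HB Require Import structures.
Require Import Defs.
From mathcomp Require Import all_boot all_order all_algebra.
From mathcomp Require Import all_classical topology.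
From mathcomp Require Import wochoice zify.

Set Implicit Arguments.
Unset Strict Implicit.
Unset Printing Implicit Defensive.

Import Order.TTheory GRing.Theory.

Local Open Scope classical_set_scope.
Local Open Scope order_scope.

(** * Compact connected orders *)

Section CompleteDenseOrder.
Context {d : Order.disp_t} {X : orderTopologicalType d}.
Implicit Types (x y z : X) (A U V : set X).

Lemma near_lt (x y : X) : x < y -> \forall z \near x, z < y.
Proof.
move=> xy; have := lray_open y; rewrite openE => /(_ x); rewrite /interior /=.
rewrite in_itv /= => /(_ xy); apply: filterS => z /=.
by rewrite in_itv.
Qed.

Lemma near_gt (x y : X) : y < x -> \forall z \near x, y < z.
Proof.
move=> xy; have := rray_open y; rewrite openE => /(_ x); rewrite /interior /=.
rewrite in_itv /= andbT => /(_ xy); apply: filterS => z /=.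
by rewrite in_itv /= andbT.
Qed.

(** Open rays form a subbase of the order topology, so a filter need only be tested on the rays that
    contain [x]. *)
Lemma nbhs_subbase (F : set_system X) x : Filter F ->
  (forall y, x < y -> F [set z | z < y]) ->
  (forall y, y < x -> F [set z | y < z]) -> nbhs x `<=` F.
Proof.
move=> FF Flt Fgt U; rewrite itv_nbhsE => -[i [oi xi] iU].
apply: filterS iU _; move: oi.
case: i xi => [[[]l|[]] [[]r|[]]] //= xi _.
- move: xi; rewrite in_itv /= => /andP[/Fgt Fl /Flt Fr].
  by apply: filterS2 Fl Fr => z /= zl zr; rewrite in_itv /= zl zr.
- move: xi; rewrite in_itv /= andbT => /Fgt.
  by apply: filterS => z; rewrite /= in_itv /= andbT.
- move: xi; rewrite in_itv /= => /Flt.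
  by apply: filterS => z; rewrite /= in_itv.
- by apply: filterS filterT => z _; rewrite /= in_itv.
Qed.

Lemma increasing_continuous (f g : X -> X) :
  {homo f : x y / x < y} -> {homo g : x y / x < y} -> cancel g f ->
  continuous f.
Proof.
move=> fm gm gK x; apply: nbhs_subbase => y yfx.
  have : x < g y.
    rewrite ltNge le_eqVlt; apply/negP=> /orP[/eqP|/fm]; last first.
      by rewrite gK => /lt_trans/(_ yfx); rewrite ltxx.
    by move=> e; move: yfx; rewrite -e gK ltxx.
  by move=> /near_lt; apply: filterS => z /fm; rewrite gK.
have : g y < x.
  rewrite ltNge le_eqVlt; apply/negP=> /orP[/eqP|/fm]; last first.
    by rewrite gK => /(lt_trans yfx); rewrite ltxx.
  by move=> e; move: yfx; rewrite e gK ltxx.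
by move=> /near_gt; apply: filterS => z /fm; rewrite gK.
Qed.

Hypothesis supX : forall A, supremums A !=set0.

Lemma complete_compact : compact [set: X].
Proof.
rewrite compact_ultra => F UF _.
(* The ultrafilter converges to the supremum of the points whose closed upper rays belong to it. *)
have [s [sub slub]] := supX [set x | F [set y | x <= y]].
exists s; split=> //; apply: nbhs_subbase => y ys.
  have nF : ~ F [set z | y <= z] by move=> /sub; rewrite leNgt ys.
  have [//|] := in_ultra_setVsetC [set z | y <= z] UF.
  by apply: filterS => z /= /negP; rewrite ltNge.
apply: contrapT => nF; have : s <= y; last by rewrite leNgt ys.
apply: slub => x /= Fx; rewrite leNgt; apply/negP => yx; apply: nF.
by apply: filterS Fx => z; exact: lt_le_trans.
Qed.

Hypothesis denseX : forall x y, x < y -> exists z, x < z < y.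

(** The supersets of segments [[x, r]] with [x < r <= c] form a filter, which by density contains
    every open ray around [x]. *)
Lemma nbhs_right x c U : x < c -> nbhs x U ->
  exists2 r, x < r <= c & forall y, x <= y <= r -> U y.
Proof.
move=> xc; pose F : set_system X :=
  [set U | exists2 r, x < r <= c & forall y, x <= y <= r -> U y].
have FF : Filter F.
  split=> [|P Q [r /andP[xr rc] Pr] [s /andP[xs sc] Qs]|P Q PQ [r xr Pr]].
  - by exists c; rewrite ?xc ?lexx.
  - exists (Order.min r s); first by rewrite lt_min xr xs ge_min rc.
    move=> y; rewrite le_min => /and3P[xy yr ys].
    by split; [apply: Pr|apply: Qs]; rewrite xy.
  - by exists r => // y /Pr /PQ.
apply: (@nbhs_subbase F) => y yx.
  have [|r /andP[xr]] := @denseX x (Order.min y c); first by rewrite lt_min yx.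
  rewrite lt_min => /andP[ry rc]; exists r; first by rewrite xr ltW.
  by move=> z /andP[_ zr]; exact: le_lt_trans ry.
by exists c; [rewrite xc lexx|move=> z /andP[xz _]; exact: lt_le_trans xz].
Qed.

Lemma nbhs_left x c U : c < x -> nbhs x U ->
  exists2 r, c <= r < x & forall y, r <= y <= x -> U y.
Proof.
move=> cx; pose F : set_system X :=
  [set U | exists2 r, c <= r < x & forall y, r <= y <= x -> U y].
have FF : Filter F.
  split=> [|P Q [r /andP[cr rx] Pr] [s /andP[cs sx] Qs]|P Q PQ [r xr Pr]].
  - by exists c; rewrite ?cx ?lexx.
  - exists (Order.max r s); first by rewrite gt_max rx sx le_max cr.
    move=> y; rewrite ge_max => /andP[/andP[ry sy] yx].
    by split; [apply: Pr|apply: Qs]; rewrite yx andbT.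
  - by exists r => // y /Pr /PQ.
apply: (@nbhs_subbase F) => y yx.
  by exists c; [rewrite cx lexx|move=> z /andP[_ zx]; exact: le_lt_trans yx].
have [|r /andP[]] := @denseX (Order.max y c) x; first by rewrite gt_max yx.
rewrite gt_max => /andP[yr cr] rx; exists r; first by rewrite rx ltW.
by move=> z /andP[rz _]; exact: lt_le_trans rz.
Qed.

(** Let [s] be the supremum of the points up to which [U] fills the interval. If [U s], then [U]
    continues beyond [s]; if [V s], then [V] reaches below [s], where density gives a common point.
    Connectedness and the intermediate value theorem both follow from this form. *)
Lemma open_cover_interval_meet U V a c : open U -> open V -> a <= c ->
  (forall x, a <= x <= c -> U x \/ V x) -> U a -> V c ->
  exists x, [/\ a <= x <= c, U x & V x].
Proof.
move=> oU oV ac UV Ua Vc; apply: contrapT => nUV.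
have UVF x : a <= x <= c -> U x -> V x -> False.
  by move=> xac Ux Vx; apply: nUV; exists x.
pose S := [set x | a <= x <= c /\ forall y, a <= y <= x -> U y].
have [s [sub slub]] := supX S.
have Sa : S a.
  split; first by rewrite lexx.
  by move=> y /andP[ay ya]; have -> : y = a by apply/eqP; rewrite eq_le ya ay.
have sac : a <= s <= c.
  rewrite sub //=; apply: slub => x [/andP[]//].
have Us y : a <= y < s -> U y.
  move=> /andP[ay ys]; apply: contrapT => nUy.
  have : s <= y; last by rewrite leNgt ys.
  apply: slub => x [_ Ux]; rewrite leNgt; apply/negP => yx.
  by apply: nUy; apply: Ux; rewrite ay ltW.
have [Uxs|Vs] := UV _ sac.
  have sc : s < c.
    rewrite lt_neqAle; case/andP: (sac) => _ ->; rewrite andbT.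
    by apply/eqP => sc; rewrite sc in Uxs; apply: (UVF c); rewrite // ac lexx.
  have : nbhs s U by move: oU; rewrite openE => /(_ _ Uxs).
  move=> /(nbhs_right sc)[r /andP[sr rc] Ur].
  have : r <= s.
    apply: sub; split.
      by rewrite rc ltW // (le_lt_trans _ sr) //; case/andP: sac.
    move=> y /andP[ay yr]; have [ys|sy] := ltP y s.
      by apply: Us; rewrite ay.
    by apply: Ur; rewrite sy.
  by rewrite leNgt sr.
have sa : a < s.
  rewrite lt_neqAle; case/andP: (sac) => -> _; rewrite andbT.
  by apply/eqP => sa; rewrite -sa in Vs; apply: (UVF a); rewrite // ac lexx.
have : nbhs s V by move: oV; rewrite openE => /(_ _ Vs).
move=> /(nbhs_left sa)[r /andP[ar rs] Vr].
have [z /andP[rz zs]] := denseX rs.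
have az : a <= z by rewrite ltW // (le_lt_trans ar).
apply: (UVF z); last by apply: Vr; rewrite !ltW.
  by rewrite az (le_trans (ltW zs)) //; case/andP: sac.
by apply: Us; rewrite az.
Qed.

Lemma complete_connected : connected [set: X].
Proof.
move=> B [a Ba] [U oU BU] [V cV BV]; apply/seteqP; split=> // c _.
rewrite setTI in BU; rewrite setTI in BV.
have oC : open (~` B) by rewrite BV; exact: closed_openC.
have oB : open B by rewrite BU.
have UV x : B x \/ (~` B) x := EM (B x).
apply: contrapT => nBc; have [ac|/ltW ca] := leP a c.
  have [x [_ Bx nBx]] :=
    open_cover_interval_meet oB oC ac (fun x _ => UV x) Ba nBc.
  exact: nBx.
have VU x : (~` B) x \/ B x by rewrite or_comm.
have [x [_ nBx Bx]] :=
  open_cover_interval_meet oC oB ca (fun x _ => VU x) nBc Ba.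
exact: nBx.
Qed.

(** * Injective continuous maps are monotone *)

Lemma increasing_ivt (f : X -> X) a b y : continuous f -> a <= b ->
  f a < y < f b -> exists2 x, a <= x <= b & f x = y.
Proof.
move=> cf ab /andP[ay yb]; apply: contrapT => nx.
have oU : open [set x | f x < y].
  rewrite openE => x /near_lt; exact: cf.
have oV : open [set x | y < f x].
  rewrite openE => x /near_gt; exact: cf.
have UV x : a <= x <= b -> [set x | f x < y] x \/ [set x | y < f x] x.
  move=> xab /=; case: (ltgtP (f x) y) => [||e]; [by left|by right|].
  by case: nx; exists x.
have [x [_ /= h1 h2]] := open_cover_interval_meet oU oV ab UV ay yb.
by move: (lt_trans h1 h2); rewrite ltxx.
Qed.

Lemma decreasing_ivt (f : X -> X) a b y : continuous f -> a <= b ->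
  f b < y < f a -> exists2 x, a <= x <= b & f x = y.
Proof.
move=> cf ab /andP[yb ay]; apply: contrapT => nx.
have oU : open [set x | f x < y].
  rewrite openE => x /near_lt; exact: cf.
have oV : open [set x | y < f x].
  rewrite openE => x /near_gt; exact: cf.
have VU x : a <= x <= b -> [set x | y < f x] x \/ [set x | f x < y] x.
  move=> xab /=; case: (ltgtP (f x) y) => [||e]; [by right|by left|].
  by case: nx; exists x.
have [x [_ /= h1 h2]] := open_cover_interval_meet oV oU ab VU ay yb.
by move: (lt_trans h1 h2); rewrite ltxx.
Qed.

(** If [f y] were not between [f x] and [f z], one of these two values would be attained a second
    time, on the other side of [y]. *)
Lemma injective_continuous_between (f : X -> X) x y z :
  continuous f -> injective f -> x < y < z ->
  (f x < f y < f z) || (f z < f y < f x).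
Proof.
move=> cf fI /andP[xy yz]; have xz := lt_trans xy yz.
have ne u v : u < v -> f u != f v.
  by move=> uv; apply/eqP => /fI e; rewrite e ltxx in uv.
have [xy' yz'] := (ltW xy, ltW yz).
have no u v w : u <= w <= v -> f w = f x -> y <= u -> False.
  by move=> /andP[uw _] /fI wx yu; move: xy; rewrite -wx ltNge (le_trans yu uw).
have no' u v w : u <= w <= v -> f w = f z -> v <= y -> False.
  by move=> /andP[_ wv] /fI wx yu; move: yz; rewrite -wx ltNge (le_trans wv yu).
move: (ne _ _ xy) (ne _ _ yz) (ne _ _ xz).
case: (ltgtP (f x) (f y)) => // fxy _.
all: case: (ltgtP (f y) (f z)) => // fyz _ nxz.
- move: nxz; case: (ltgtP (f x) (f z)) => // fxz _.
    have [|w ww e] := @increasing_ivt f x y (f z) cf xy'; first by rewrite fxz.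
    by case: (no' _ _ _ ww e).
  have [|w ww e] := @decreasing_ivt f y z (f x) cf yz'; first by rewrite fxz.
  by case: (no _ _ _ ww e).
- move: nxz; case: (ltgtP (f x) (f z)) => // fxz _.
    have [|w ww e] := @increasing_ivt f y z (f x) cf yz'; first by rewrite fxy.
    by case: (no _ _ _ ww e).
  have [|w ww e] := @decreasing_ivt f x y (f z) cf xy'; first by rewrite fyz.
  by case: (no' _ _ _ ww e).
Qed.

(** The comparison of [f o] with [f t] at the two endpoints fixes the direction. It passes first to
    the pairs [(o, y)], then to all pairs. *)
Lemma injective_continuous_monotone (f : X -> X) :
  continuous f -> injective f ->
  {homo f : x y / x < y} \/ {homo f : x y / x < y >-> y < x}.
Proof.
move=> cf fI.
have [t [tub _]] := supX [set: X]; have [o [_ olub]] := supX set0.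
have oP x : o <= x by exact: olub.
have tP x : x <= t by exact: tub.
have bet := injective_continuous_between cf fI.
have inj x y : x < y -> f x != f y.
  by move=> xy; apply/eqP => /fI e; rewrite e ltxx in xy.
have [fot|fto|] := ltgtP (f o) (f t); last first.
(* Equal end values identify the endpoints, so the space is a single point. *)
- move=> /fI ot; left=> x y; have E z : z = o.
    by apply/eqP; rewrite eq_le oP andbT ot tP.
  by rewrite (E x) (E y) ltxx.
- have oy y : o < y -> f y < f o.
    move=> oy; move: (tP y); rewrite le_eqVlt => /orP[/eqP -> //|yt].
    have := bet o y t; rewrite oy yt => /(_ isT) /orP[/andP[]|/andP[]//].
    by move=> h1 h2; move: (lt_trans fto (lt_trans h1 h2)); rewrite ltxx.
  right=> x y xy; move: (oP x); rewrite le_eqVlt => /orP[/eqP ox|ox].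
    by rewrite -ox oy // ox.
  have := bet o x y; rewrite ox xy => /(_ isT) /orP[/andP[]|/andP[]//].
  by rewrite ltNge ltW // oy.
- have oy y : o < y -> f o < f y.
    move=> oy; move: (tP y); rewrite le_eqVlt => /orP[/eqP -> //|yt].
    have := bet o y t; rewrite oy yt => /(_ isT) /orP[/andP[]//|/andP[]].
    by move=> h1 h2; move: (lt_trans fot (lt_trans h1 h2)); rewrite ltxx.
  left=> x y xy; move: (oP x); rewrite le_eqVlt => /orP[/eqP ox|ox].
    by rewrite -ox oy // ox.
  have := bet o x y; rewrite ox xy => /(_ isT) /orP[/andP[]//|/andP[]].
  by move=> _; rewrite ltNge ltW // oy.
Qed.
End CompleteDenseOrder.

(** * Dedekind cuts *)

Section Cut.
Context {d : Order.disp_t} {D : orderType d}.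
Variable V : set D.

(* Lower sets without maximum, so that the cut of p is {q | q < p} *)
Definition is_cut (A : set D) : Prop :=
  [/\ A `<=` V, forall p q, V q -> q < p -> A p -> A q &
      forall p, A p -> exists2 q, A q & p < q].

Definition cut : Type := {A : set D | is_cut A}.

HB.instance Definition _ := gen_eqMixin cut.
HB.instance Definition _ := gen_choiceMixin cut.

Implicit Types x y : cut.

Lemma cut_ext x y : sval x = sval y -> x = y.
Proof. by case: x y => [A cA] [B cB] /= AB; apply: eq_exist. Qed.

Definition le_cut x y : bool := `[< sval x `<=` sval y >].

Lemma le_cut_refl : reflexive le_cut.
Proof. by move=> x; apply/asboolP. Qed.

Lemma le_cut_anti : antisymmetric le_cut.
Proof.
move=> x y /andP[/asboolP xy /asboolP yx].
by apply: cut_ext; apply/seteqP; split.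
Qed.

Lemma le_cut_trans : transitive le_cut.
Proof.
by move=> y x z /asboolP xy /asboolP yz; apply/asboolP; exact: subset_trans yz.
Qed.

HB.instance Definition _ :=
  Order.Le_isPOrder.Build d cut le_cut_refl le_cut_anti le_cut_trans.

Lemma le_cutP x y : reflect (sval x `<=` sval y) (x <= y).
Proof. exact: asboolP. Qed.

Lemma nle_cutP x y : ~~ (x <= y) -> exists2 p, sval x p & ~ sval y p.
Proof. by move=> /le_cutP/nonsubset[p [xp nyp]]; exists p. Qed.

Lemma le_cut_total : total (<=%O : rel cut).
Proof.
move=> x y; apply/orP; apply: contrapT => /not_orP[].
move=> /negP/nle_cutP[p xp nyp] /negP/nle_cutP[q yq nxq].
have [[xV xdown _] [yV ydown _]] := (svalP x, svalP y).
have [pq|qp|e] := ltgtP p q.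
- by apply: nyp; apply: ydown pq yq; exact: xV.
- by apply: nxq; apply: xdown qp xp; exact: yV.
- by apply: nyp; rewrite e.
Qed.

HB.instance Definition _ := Order.POrder_isTotal.Build d cut le_cut_total.

Hypothesis denseV :
  forall p q, V p -> V q -> p < q -> exists2 r, V r & p < r < q.

(** Density leaves room between [p] and a member of [A] above it, so there is no maximum. Singletons
    give the cuts of points, and unions of cuts give suprema. *)
Lemma is_cut_down (A : set D) :
  is_cut [set p | V p /\ exists2 q, V q & A q /\ p < q].
Proof.
split=> [p []//|p q Vq qp [Vp [r Vr [Ar pr]]]|p [Vp [q Vq [Aq pq]]]].
  by split=> //; exists r => //; split=> //; exact: lt_trans pr.
have [r Vr /andP[pr rq]] := denseV Vp Vq pq.
by exists r => //; split=> //; exists q.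
Qed.

Definition down_cut (A : set D) : cut := exist _ _ (is_cut_down A).

Definition point_cut (p : D) : cut := down_cut [set p].

Lemma point_cutE p q : V p -> sval (point_cut p) q <-> V q /\ q < p.
Proof.
move=> Vp; split=> [[Vq [_ _ [-> //]]]|[Vq qp]].
by split=> //; exists p.
Qed.

Lemma mem_cut x p : V p -> sval x p <-> point_cut p < x.
Proof.
have [xV xdown _] := svalP x.
move=> Vp; split=> [xp|].
  rewrite ltNge; apply/le_cutP => /(_ _ xp)/(point_cutE _ Vp)[_].
  by rewrite ltxx.
rewrite ltNge => /nle_cutP[q xq npq]; apply: contrapT => nxp; apply: npq.
apply/point_cutE => //; split; first exact: xV.
rewrite ltNge le_eqVlt; apply/negP => /orP[/eqP e|pq].
  by apply: nxp; rewrite e.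
by apply: nxp; exact: xdown pq xq.
Qed.

Lemma lt_point_cut p q : V p -> V q -> (point_cut p < point_cut q) = (p < q).
Proof.
move=> Vp Vq; apply/idP/idP => [/mem_cut-/(_ Vp)/point_cutE-/(_ Vq)[]//|pq].
by apply/mem_cut => //; apply/point_cutE.
Qed.

Lemma point_cut_dense x y : x < y -> exists2 p, V p & x < point_cut p < y.
Proof.
have [[xV xdown _] [yV ydown yup]] := (svalP x, svalP y).
rewrite ltNge => /nle_cutP[q yq nxq].
(* [y] has no maximum, so [p] can be taken above [q]; then [q] separates [x] strictly from the cut
   of [p]. *)
have [p yp qp] := yup _ yq; have Vp := yV _ yp.
exists p => //; apply/andP; split; last exact/mem_cut.
rewrite ltNge; apply/le_cutP => /(_ q) h; apply: nxq; apply: h.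
by apply/point_cutE => //; split=> //; exact: yV.
Qed.

Lemma cut_supremums (A : set cut) : supremums A !=set0.
Proof.
exists (down_cut [set p | exists2 x, A x & sval x p]); split=> [x Ax|y yub].
  apply/le_cutP => p xp; have [xV _ xup] := svalP x.
  have [q xq pq] := xup _ xp; split; first exact: xV.
  by exists q; [exact: xV|split=> //; exists x].
apply/le_cutP => p [Vp [q Vq [[x Ax xq] pq]]].
have [_ ydown _] := svalP y.
by apply: ydown pq _ => //; move/le_cutP: (yub _ Ax); apply.
Qed.

Section Shift.
Variables g g' : D -> D.
Hypotheses (gK : cancel g g') (g'K : cancel g' g).
Hypothesis gV : forall p, V p -> V (g p).
Hypothesis g'V : forall p, V p -> V (g' p).
Hypothesis g_lt : {homo g : p q / p < q}.
Hypothesis g'_lt : {homo g' : p q / p < q}.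

Lemma is_cut_preimage x : is_cut [set p | sval x (g' p)].
Proof.
have [xV xdown xup] := svalP x.
split=> /= [p /xV /gV|p q Vq qp|p /xup[q xq pq]]; first by rewrite g'K.
  by apply: xdown; [exact: g'V|exact: g'_lt].
by exists (g q); rewrite /= ?gK // -(g'K p); exact: g_lt.
Qed.

(** The direct image of the cut under [g], written as a preimage under its inverse [g']. *)
Definition map_cut x : cut := exist _ _ (is_cut_preimage x).

Lemma map_cut_point p : V p -> map_cut (point_cut p) = point_cut (g p).
Proof.
move=> Vp; apply: cut_ext; apply/seteqP; split=> q /=.
  move=> /point_cutE-/(_ Vp)[Vq qp]; apply/point_cutE; first exact: gV.
  by rewrite -(g'K q); split; [exact: gV|exact: g_lt].
move=> /point_cutE-/(_ (gV Vp))[Vq qp]; apply/point_cutE => //.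
by rewrite -(gK p); split; [exact: g'V|exact: g'_lt].
Qed.

Lemma map_cut_homo : {homo map_cut : x y / x <= y}.
Proof. by move=> x y /le_cutP xy; apply/le_cutP => p /=; exact: xy. Qed.

End Shift.

End Cut.

(** * Alphabets *)

(** Iterated power sets of [nat]: Cantor's theorem at each step yields the infinitely many cardinals
    needed for distinct alphabets. *)
Fixpoint beth (n : nat) : Type := if n is m.+1 then set (beth m) else nat.

Fixpoint beth0 (n : nat) : beth n := if n is m.+1 then set0 else 0%N.

Fixpoint beth1 (n : nat) : beth n :=
  if n is m.+1 then [set beth0 m] else 1%N.

Lemma beth01 n : beth0 n <> beth1 n.
Proof. by case: n => [//|n] /= /seteqP[_ /(_ (beth0 n))]; apply. Qed.

Lemma beth_pair n : exists p : beth n -> beth n -> beth n,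
  forall x y x' y', p x y = p x' y' -> x = x' /\ y = y'.
Proof.
elim: n => [|n [p pI]].
  exists (fun x y => pickle (x, y)) => x y x' y' /(pcan_inj pickleK)[-> ->].
  by [].
(* Two sets are coded as the union of two disjoint copies, tagged by the distinct elements [beth0 n]
   and [beth1 n]. *)
exists (fun P Q => [set z | (exists2 x, P x & z = p (beth0 n) x) \/
                            (exists2 x, Q x & z = p (beth1 n) x)]).
have aux (P P' Q Q' : set (beth n)) :
    [set z | (exists2 x, P x & z = p (beth0 n) x) \/
             (exists2 x, Q x & z = p (beth1 n) x)] `<=`
    [set z | (exists2 x, P' x & z = p (beth0 n) x) \/
             (exists2 x, Q' x & z = p (beth1 n) x)] -> P `<=` P' /\ Q `<=` Q'.
  move=> PQ; split=> x xP.
    have [|[y P'y /pI[_ -> //]]|[y _ /pI[/beth01]]//] := PQ (p (beth0 n) x).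
    by left; exists x.
  have [|[y _ /pI[/esym/beth01]]//|[y P'y /pI[_ -> //]]] := PQ (p (beth1 n) x).
  by right; exists x.
by move=> P Q P' Q' /seteqP[/aux[PP' QQ'] /aux[P'P Q'Q]]; split; apply/seteqP.
Qed.

Lemma beth_cantor n (f : beth n.+1 -> beth n) : ~ injective f.
Proof.
move=> fI; pose A : beth n.+1 := [set z | exists2 B, f B = z & ~ B z].
have [Az|nAz] := EM (A (f A)); last by apply: (nAz); exists A.
by case: (Az) => B /fI -> nA; exact: nA Az.
Qed.

(** * Sets of cardinality at most that of [beth n] *)

Definition small n {U : Type} (A : set U) : Prop :=
  exists f : U -> beth n, {in A &, injective f}.

Section Small.
Context {U : Type}.
Implicit Types A B : set U.

Lemma small_sub n A B : A `<=` B -> small n B -> small n A.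
Proof.
move=> AB [f fI]; exists f => x y /set_mem/AB xB /set_mem/AB yB.
by apply: fI; exact: mem_set.
Qed.

Lemma smallS n A : small n A -> small n.+1 A.
Proof.
move=> [f fI]; exists (fun x => [set f x]) => x y xA yA /seteqP[/(_ _ erefl)].
by move=> /fI-/(_ xA yA).
Qed.

Lemma small_le m n A : (m <= n)%N -> small m A -> small n A.
Proof.
by move=> /subnK <-; elim: (n - m)%N => [//|k IH] /IH; exact: smallS.
Qed.

End Small.

Lemma small_nat n (A : set nat) : small n A.
Proof. by apply: (@small_le _ 0) => //; exists id. Qed.

Section SmallUnion.
Context {U : Type}.
Implicit Types A B : set U.

(** An element is coded by an index chosen for it, paired with its code in that member of the
    family. This is what makes the alphabets regular. *)
Lemma small_bigcup n (I : Type) (D : set I) (F : I -> set U) :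
  small n D -> (forall i, D i -> small n (F i)) ->
  small n (\bigcup_(i in D) F i).
Proof.
move=> [j jI] smF; have [p pI] := beth_pair n.
have [[i0 _]|D0] := pselect (D !=set0); last first.
  exists (fun=> beth0 n) => x y /set_mem[i Di _].
  by case: D0; exists i.
have /choice[g gP] : forall i, exists f : U -> beth n,
    D i -> {in F i &, injective f}.
  move=> i; have [/smF[f fI]|nDi] := EM (D i); first by exists f.
  by exists (fun=> beth0 n).
have /choice[c cP] : forall x, exists i, (\bigcup_(i in D) F i) x ->
    D i /\ F i x.
  move=> x; have [[i Di Fx]|nx] := EM ((\bigcup_(i in D) F i) x).
    by exists i.
  by exists i0.
exists (fun x => p (j (c x)) (g (c x) x)) => x y /set_mem/cP[Dx Fx].
move=> /set_mem/cP[Dy Fy] /pI[/jI].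
move=> /(_ (mem_set Dx) (mem_set Dy)) cxy; rewrite -cxy in Fy *.
by apply: gP => //; exact: mem_set.
Qed.

Lemma small_set1 n (x : U) : small n [set x].
Proof. by exists (fun=> beth0 n) => y z /set_mem-> /set_mem->. Qed.

Lemma small_setU n A B : small n A -> small n B -> small n (A `|` B).
Proof.
move=> sA sB; rewrite -bigcup2inE; apply: small_bigcup; last first.
  by move=> [//|[//|i /=]]; rewrite ltnS ltnS ltn0.
exact: small_nat.
Qed.

End SmallUnion.

(** A single type for all letters, with one well-order: words stay plain sequences, and the tag
    tells the alphabets apart. *)
Definition letter : Type := {n & beth n}.

HB.instance Definition _ := gen_eqMixin letter.
HB.instance Definition _ := gen_choiceMixin letter.

Definition le_letter : rel letter := sval (well_ordering_principle letter).

Lemma le_letter_min (A : set letter) : A !=set0 ->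
  exists2 a, A a & forall b, A b -> le_letter a b.
Proof.
move=> [b Ab]; have := svalP (well_ordering_principle letter).
move=> /(_ [pred x | x \in A])[]; first by exists b; exact: mem_set.
by move=> a [[/set_mem Aa amin] _]; exists a => // c /mem_set; exact: amin.
Qed.

Lemma le_letter_refl : reflexive le_letter.
Proof. by move=> x; have [|_ -> ->//] := @le_letter_min [set x]; exists x. Qed.

Lemma le_letter_anti : antisymmetric le_letter.
Proof.
move=> x y /andP[xy yx]; have := svalP (well_ordering_principle letter).
move=> /(_ [pred z | (z == x) || (z == y)])[].
  by exists x; rewrite inE eqxx.
move=> z [_ zu]; rewrite -(zu x) ?(zu y) //; split; rewrite ?inE ?eqxx ?orbT //.
  by move=> w /orP[/eqP->|/eqP->] //; exact: le_letter_refl.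
by move=> w /orP[/eqP->|/eqP->] //; exact: le_letter_refl.
Qed.

Lemma le_letter_total : total le_letter.
Proof.
move=> x y; have [|_ [->|->] m] := @le_letter_min [set x; y].
- by exists x; left.
- by rewrite m //; right.
- by rewrite m ?orbT //; left.
Qed.

Lemma le_letter_trans : transitive le_letter.
Proof.
move=> y x z xy yz.
have [|a + m] := @le_letter_min [set x; y; z]; first by exists x; do 2 left.
move=> [[e|e]|e]; rewrite {}e in m; first by apply: m; right.
  have yx : le_letter y x by apply: m; do 2 left.
  by have -> : x = y by apply: le_letter_anti; rewrite xy.
have zy : le_letter z y by apply: m; left; right.
by have <- : y = z by apply: le_letter_anti; rewrite zy yz.
Qed.

HB.instance Definition _ := Order.Le_isPOrder.Build Order.default_display letter
  le_letter_refl le_letter_anti le_letter_trans.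
HB.instance Definition _ :=
  Order.POrder_isTotal.Build Order.default_display letter le_letter_total.

Lemma letter_min (A : set letter) : A !=set0 ->
  exists2 a, A a & forall b, A b -> a <= b.
Proof. exact: le_letter_min. Qed.

Definition initial n (a : letter) : set letter :=
  [set c : letter | tag c = n.+1 /\ c <= a].

(* Its order type is the successor cardinal of [beth n], hence regular *)
Definition alphabet n : set letter :=
  [set a : letter | tag a = n.+1 /\ small n (initial n a)].

Lemma small_alphabet n : small n.+1 (alphabet n).
Proof.
have /choice[f fP] : forall a : letter, exists t : beth n.+1,
    tag a = n.+1 -> a = existT _ n.+1 t.
  move=> [k t]; have [e|ne] := eqVneq k n.+1; last first.
    by exists (beth0 n.+1) => /= e; rewrite e eqxx in ne.
  by subst k; exists t.
exists f => a b /set_mem[/fP aE _] /set_mem[/fP bE _] e.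
by rewrite aE bE e.
Qed.

(** If the alphabet were small, so would be the initial segment of the first letter of tag [n.+1]
    outside it, which would then belong to it. Hence every letter of this tag would belong to it,
    against Cantor's theorem. *)
Lemma alphabet_not_small n : ~ small n (alphabet n).
Proof.
move=> sA; have [f fI] : small n [set a : letter | tag a = n.+1].
  apply: small_sub (sA); apply: contrapT => /nonsubset.
  move=> /letter_min[a [ta nAa] am].
  apply: nAa; split=> //; apply: (@small_sub _ _ _ (alphabet n `|` [set a])).
    move=> c [tc ca]; apply: contrapT => /not_orP[nAc ca'].
    by apply: ca'; apply/le_anti; rewrite ca am.
  by apply: small_setU => //; exact: small_set1.
apply: (@beth_cantor n (fun t => f (existT _ n.+1 t))) => t u /fI.
rewrite !inE => /(_ erefl erefl) e.
by move: (projT2_eq e); rewrite (eq_irrelevance (projT1_eq e) erefl).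
Qed.

(** Regularity: otherwise the alphabet would be covered by initial segments, small in number and
    each small, hence small itself. *)
Lemma alphabet_bounded n (I : Type) (D : set I) (a : I -> letter) :
  small n D -> (forall i, D i -> alphabet n (a i)) ->
  exists2 c, alphabet n c & forall i, D i -> a i < c.
Proof.
move=> sD aD; apply: contrapT => nb; apply: (@alphabet_not_small n).
apply: (@small_sub _ _ _ (\bigcup_(i in D) initial n (a i))); last first.
  by apply: small_bigcup => // i /aD[].
move=> c Ac; apply: contrapT => nc; apply: nb; exists c => // i Di.
rewrite ltNge; apply/negP => ca; apply: nc; exists i => //.
by split=> //; case: Ac.
Qed.

Lemma alphabet_next n a : alphabet n a ->
  exists b, [/\ alphabet n b, a < b &
    forall c, alphabet n c -> a < c -> b <= c].
Proof.
move=> Aa; have [c Ac ac] := @alphabet_bounded n _ [set a] id (small_set1 _ _)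
  ltac:(by move=> _ ->).
have [|b [Ab ab] bm] := @letter_min [set b | alphabet n b /\ a < b].
  by exists c; split; last exact: ac.
by exists b; split=> // e Ae ae; exact: bm.
Qed.

Lemma alphabet_min n :
  exists2 a, alphabet n a & forall c, alphabet n c -> a <= c.
Proof.
apply: letter_min.
have [c Ac _] := @alphabet_bounded n _ (@set0 nat)
  (fun=> existT beth 0%N 0%N) (small_nat _ _) ltac:(by []).
by exists c.
Qed.

(** * Words *)

(** A boolean for the direction lets one argument serve both sides of a point and both parities of
    the level. *)
Definition dlt {d} {T : porderType d} (b : bool) (x y : T) : bool :=
  if b then y < x else x < y.

Notation "x <_[ b ] y" := (dlt b x y)
  (at level 70, format "x  <_[ b ]  y") : order_scope.

Section DirectedOrder.
Context {d : Order.disp_t} {T : orderType d}.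
Implicit Types (x y z : T) (b : bool).

Lemma dltN b x y : (x <_[~~ b] y) = (y <_[b] x).
Proof. by case: b. Qed.

Lemma dlt_irr b x : (x <_[b] x) = false.
Proof. by case: b => /=; rewrite /dlt ltxx. Qed.

Lemma dlt_trans b : transitive (@dlt _ T b).
Proof.
by case: b => y x z /= h1 h2; [exact: lt_trans h2 h1|exact: lt_trans h1 h2].
Qed.

Lemma dlt_total b x y : x != y -> (x <_[b] y) || (y <_[b] x).
Proof. by case: b; rewrite /dlt neq_lt // orbC. Qed.

Lemma dlt_asym b x y : x <_[b] y -> (y <_[b] x) = false.
Proof. by move=> h; apply/negP => /(dlt_trans h); rewrite dlt_irr. Qed.

End DirectedOrder.

(** [b] is the direction at the current letter. In that direction the end of a word comes before
    every letter. *)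
Fixpoint alt_lt (b : bool) (s t : seq letter) : bool :=
  match s, t with
  | [::], [::] => false
  | [::], _ :: _ => ~~ b
  | _ :: _, [::] => b
  | x :: s', y :: t' => if x == y then alt_lt (~~ b) s' t' else x <_[b] y
  end.

Lemma alt_lt_irr b s : alt_lt b s s = false.
Proof. by elim: s b => [|x s IH] b //=; rewrite eqxx. Qed.

Lemma alt_ltN b s t : alt_lt (~~ b) s t = alt_lt b t s.
Proof.
elim: s t b => [|x s IH] [|y t] b //=; first by rewrite negbK.
by rewrite eq_sym; case: eqP => // _; rewrite dltN.
Qed.

Lemma alt_lt_trans b : transitive (alt_lt b).
Proof.
move=> t s u; elim: s t u b => [|x s IH] [|y t] [|z u] b //=.
- by case: b.
- by case: b.
- have [xy|xy] := eqVneq x y; have [yz|yz] := eqVneq y z; subst.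
  + by rewrite eqxx; exact: IH.
  + by rewrite (negPf yz).
  + by rewrite (negPf xy).
  + have [<-|_] := eqVneq x z; last exact: dlt_trans.
    by move=> /dlt_asym->.
Qed.

Lemma alt_lt_total b s t : s != t -> alt_lt b s t || alt_lt b t s.
Proof.
elim: s t b => [|x s IH] [|y t] b //=; [by case: b|by case: b|].
rewrite eqseq_cons (eq_sym y x); case: eqP => [_|/eqP xy] /=; first exact: IH.
by move=> _; exact: dlt_total.
Qed.

Lemma alt_lt_cat b u s t :
  alt_lt b (u ++ s) (u ++ t) = alt_lt (b (+) odd (size u)) s t.
Proof.
elim: u b => [|x u IH] b /=; first by rewrite addbF.
by rewrite eqxx IH addNb addbN.
Qed.

(** The comparison with [u] is settled before [s] is exhausted. *)
Lemma alt_lt_prefixr b s t u :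
  ~~ prefix s u -> alt_lt b u (s ++ t) = alt_lt b u s.
Proof.
elim: s u b => [|x s IH] [|y u] b //=; rewrite eq_sym.
by case: eqP => //= _; exact: IH.
Qed.

Lemma alt_lt_prefixl b s t u :
  ~~ prefix s u -> alt_lt b (s ++ t) u = alt_lt b s u.
Proof. by move=> su; rewrite -[LHS]alt_ltN -[RHS]alt_ltN alt_lt_prefixr. Qed.

Lemma seq_diverge (T : eqType) (s t : seq T) : s != t ->
  exists u s' t', [/\ s = u ++ s', t = u ++ t' & ohead s' != ohead t'].
Proof.
elim: s t => [|x s IH] [|y t] //.
- by exists [::], [::], (y :: t).
- by exists [::], (x :: s), [::].
rewrite eqseq_cons; have [<- /=|xy _] := eqVneq x y; last first.
  by exists [::], (x :: s), (y :: t).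
by move=> /IH[u [s' [t' [-> -> st]]]]; exists (x :: u), s', t'.
Qed.

(** * Words and cylinders *)

Record word : Type := Word { base : int; trail : seq letter }.

HB.instance Definition _ := gen_eqMixin word.
HB.instance Definition _ := gen_choiceMixin word.

Implicit Types p q r m : word.

Definition lt_word p q : bool :=
  (base p < base q) || (base p == base q) && alt_lt false (trail p) (trail q).

Lemma lt_word_irr : irreflexive lt_word.
Proof. by move=> p; rewrite /lt_word ltxx alt_lt_irr andbF. Qed.

Lemma lt_word_trans : transitive lt_word.
Proof.
move=> q p r; rewrite /lt_word => /orP[pq|/andP[/eqP -> pq]].
  by move=> /orP[/(lt_trans pq)->//|/andP[/eqP<- _]]; rewrite pq.
move=> /orP[->//|/andP[/eqP -> qr]]; rewrite eqxx /=.
by rewrite (alt_lt_trans pq qr) orbT.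
Qed.

HB.instance Definition _ := Order.Lt_isPOrder.Build Order.default_display word
  lt_word_irr lt_word_trans.

Lemma ltwE p q : (p < q) =
  (base p < base q) || (base p == base q) && alt_lt false (trail p) (trail q).
Proof. by []. Qed.

Lemma lt_word_total : total (<=%O : rel word).
Proof.
move=> p q; have [->|] := eqVneq p q; first by rewrite lexx.
case: p q => [i s] [j t] ne; rewrite !le_eqVlt !ltwE /=.
have [||ij] := ltgtP i j; rewrite ?orbT //=; subst j.
have /(alt_lt_total false)/orP[->|->] : s != t; rewrite ?orbT //.
by apply: contra_neq ne => ->.
Qed.

HB.instance Definition _ :=
  Order.POrder_isTotal.Build Order.default_display word lt_word_total.

Definition level p : nat := size (trail p).

Definition ext p (t : seq letter) : word := Word (base p) (trail p ++ t).

Definition extends p q : bool :=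
  (base q == base p) && prefix (trail p) (trail q).

Definition child p (a : letter) : word := ext p [:: a].

Definition int_word (i : int) : word := Word i [::].

Lemma extendsP p q : reflect (exists t, q = ext p t) (extends p q).
Proof.
apply: (iffP andP) => [[/eqP e /prefixP[t pt]]|[t ->]].
  by exists t; case: q e pt => i s /= -> ->.
by rewrite /= eqxx prefix_prefix.
Qed.

Lemma ext0 p : ext p [::] = p.
Proof. by case: p => i s; rewrite /ext cats0. Qed.

Lemma ext_ext p s t : ext (ext p s) t = ext p (s ++ t).
Proof. by rewrite /ext /= catA. Qed.

Lemma ext_child p a t : ext (child p a) t = ext p (a :: t).
Proof. exact: ext_ext. Qed.

Lemma level_ext p t : level (ext p t) = (level p + size t)%N.
Proof. exact: size_cat. Qed.

Lemma level_child p a : level (child p a) = (level p).+1.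
Proof. by rewrite level_ext addn1. Qed.

Lemma extends_refl p : extends p p.
Proof. by apply/extendsP; exists [::]; rewrite ext0. Qed.

Lemma extends_ext p t : extends p (ext p t).
Proof. by apply/extendsP; exists t. Qed.

Lemma extends_level p q : extends p q -> (level p <= level q)%N.
Proof. by move=> /extendsP[t ->]; rewrite level_ext leq_addr. Qed.

Lemma wordP p : p = int_word (base p) \/ exists m a, p = child m a.
Proof.
case: p => i s; elim/last_ind: s => [|s a _]; [by left|right].
by exists (Word i s), a; rewrite /child /ext /= cats1.
Qed.

(** The comparison is settled where [q] leaves [p]; this makes the cylinder of extensions of [p]
    convex. *)
Lemma dlt_extr b p q t : ~~ extends p q -> (q <_[b] ext p t) = (q <_[b] p).
Proof.
rewrite /extends negb_and; case: b; rewrite /dlt !ltwE /=.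
  rewrite (eq_sym (base p)); case: eqP => //= _ /alt_lt_prefixl->//.
by case: eqP => //= _ /alt_lt_prefixr->.
Qed.

Lemma dlt_extl b p q t : ~~ extends p q -> (ext p t <_[b] q) = (p <_[b] q).
Proof. by move=> npq; rewrite -!(dltN b) dlt_extr. Qed.

(* In the direction [odd (level p)], the word [p] comes first among its
   extensions and its children come in the order of the letters *)
Lemma dlt_ext p s t :
  (ext p s <_[odd (level p)] ext p t) = alt_lt false s t.
Proof.
rewrite /dlt !ltwE /= eqxx ltxx /= !alt_lt_cat /level.
by case: (odd _); rewrite //= -alt_ltN.
Qed.

Lemma dlt_self_child p a t : p <_[odd (level p)] ext p (a :: t).
Proof. by rewrite -{2}(ext0 p) dlt_ext. Qed.

Lemma dlt_child p a a' t t' : a < a' ->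
  ext p (a :: t) <_[odd (level p)] ext p (a' :: t').
Proof. by move=> aa'; rewrite dlt_ext /= lt_eqF. Qed.

Lemma extends_between b p q q' r : extends p q -> extends p q' ->
  q <_[b] r -> r <_[b] q' -> extends p r.
Proof.
move=> /extendsP[t ->] /extendsP[t' ->] qr rq; apply: contraT => npr.
move: qr rq; rewrite dlt_extl // dlt_extr // => /dlt_trans h /h.
by rewrite dlt_irr.
Qed.

Fixpoint valid_from (n : nat) (s : seq letter) : Prop :=
  if s is a :: s' then alphabet n a /\ valid_from n.+1 s' else True.

Lemma valid_from_cat n s t :
  valid_from n (s ++ t) <-> valid_from n s /\ valid_from (n + size s) t.
Proof.
elim: s n => [|a s IH] n /=; first by rewrite addn0; split=> [//|[]].
by rewrite IH addSnnS; split=> [[? []]|[[]]].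
Qed.

Definition valid : set word := [set p | valid_from 0 (trail p)].

Lemma valid_ext p t :
  valid (ext p t) <-> valid p /\ valid_from (level p) t.
Proof. exact: valid_from_cat. Qed.

Lemma valid_child p a : valid (child p a) <-> valid p /\ alphabet (level p) a.
Proof. by rewrite valid_ext /=; split=> [[? []]|[]]. Qed.

Lemma valid_int_word i : valid (int_word i).
Proof. by []. Qed.

(** No alphabet has a last letter: from [p] one passes to its first child, and from an extension of
    [child p a] to the next child of [p]. *)
Lemma ext_unbounded p q : valid q -> extends p q ->
  exists r, [/\ valid r, extends p r & q <_[odd (level p)] r].
Proof.
move=> + /extendsP[t qE]; rewrite {q}qE => /valid_ext[vp].
case: t => [_|a t [Aa _]].
  have [a Aa _] := alphabet_min (level p).
  exists (child p a); rewrite ext0; split; first exact/valid_child.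
    exact: extends_ext.
  exact: dlt_self_child.
have [b [Ab ab _]] := alphabet_next Aa.
exists (child p b); split; [exact/valid_child|exact: extends_ext|].
exact: dlt_child.
Qed.

Lemma dense_ext m s t : valid (ext m t) -> alt_lt false s t ->
  ohead s != ohead t -> exists2 r, valid r &
    (ext m s <_[odd (level m)] r) && (r <_[odd (level m)] ext m t).
Proof.
case: t => [|a t] vt; first by case: s.
(* The direction reverses from [m] to its child, so in the direction of [m] the cylinder of
   [child m a] has no first word and contains [r] before [ext m t]. The word [ext m s] is [m] or
   branches off there, and precedes the whole cylinder. *)
have [|r [+ /extendsP[w rE]]] := @ext_unbounded (child m a) _ vt.
  by rewrite -ext_child extends_ext.
rewrite {}rE => vr; rewrite level_child /= dltN => rt st sa.
exists (ext (child m a) w).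
  exact: vr.
rewrite rt andbT ext_child dlt_ext; case: s st sa => //= c s.
by case: eqP => [->|//]; rewrite eqxx.
Qed.

Lemma valid_dense p q : valid p -> valid q -> p < q ->
  exists2 r, valid r & p < r < q.
Proof.
move=> vp vq pq; have [bpq|bpq] := boolP (base p < base q).
  have [|r [vr /extendsP[t rE] pr]] := @ext_unbounded (int_word (base p)) p vp.
    by rewrite /extends eqxx prefix0s.
  by exists r => //; apply/andP; split=> //; rewrite ltwE rE /= bpq.
have be : base p = base q.
  by move: pq; rewrite ltwE (negPf bpq) => /andP[/eqP].
have /seq_diverge[u [s [t [pE qE st]]]] : trail p != trail q.
  by apply: contraTneq pq => e; rewrite ltwE be ltxx e alt_lt_irr andbF.
pose m := Word (base p) u.
have {}pE : p = ext m s by rewrite /ext /m /= -pE; case: (p).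
have {}qE : q = ext m t by rewrite /ext /m /= be -qE; case: (q).
have := dlt_ext m s t; have := dlt_ext m t s; rewrite -pE -qE /dlt.
rewrite {}pE {}qE in vp vq pq *.
have st' : ohead t != ohead s by rewrite eq_sym.
(* The parity at the branching word [m] decides which of the two words is the later one in the
   direction of [m]. *)
case: (boolP (odd (level m))) => om; rewrite pq => h1 h2.
  have [r vr] := dense_ext vp (esym h1) st'.
  by rewrite /dlt om => rP; exists r; rewrite // andbC.
have [r vr] := dense_ext vq (esym h2) st.
by rewrite /dlt (negPf om) => rP; exists r.
Qed.

(** * Cofinalities *)

(* The cofinality of the side [{y | y <_[b] x}] is that of [alphabet k] *)
Definition has_character {d} {T : porderType d} (b : bool) (x : T) (k : nat) :=
  exists f : letter -> T,
    [/\ forall a a', alphabet k a -> alphabet k a' -> a < a' -> f a <_[b] f a',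
        forall a, alphabet k a -> f a <_[b] x &
        forall y, y <_[b] x -> exists2 a, alphabet k a & y <_[b] f a].

Lemma neq_negb (b c : bool) : b != c -> b = ~~ c.
Proof. by case: b c => -[]. Qed.

Section Character.
Context {d : Order.disp_t} {T : orderType d}.
Implicit Types (x y : T) (b : bool).

(** Each [g i] is dominated by some [f a]. By regularity the letters so chosen have an upper bound
    [c] in the alphabet, and no [g i] reaches [f c]. *)
Lemma has_character_not_small b x k (I : Type) (A : set I) (g : I -> T) :
  has_character b x k -> small k A -> (forall i, A i -> g i <_[b] x) ->
  ~ (forall y, y <_[b] x -> exists2 i, A i & ~~ (g i <_[b] y)).
Proof.
move=> [f [f_incr fx f_cof]] sA gx g_cof.
have [a0 _ _] := alphabet_min k.
have /choice[a aP] : forall i, exists a, A i -> alphabet k a /\ g i <_[b] f a.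
  move=> i; have [Ai|nAi] := EM (A i); last by exists a0.
  by have [a Aa ga] := f_cof _ (gx _ Ai); exists a.
have [c Ac ac] := alphabet_bounded sA (fun i Ai => (aP i Ai).1).
have [i Ai /negP] := g_cof _ (fx _ Ac); apply.
have [Aai gi] := aP i Ai.
by apply: dlt_trans gi (f_incr _ _ _ _ _) => //; exact: ac.
Qed.

Lemma has_character_inj b x k l :
  has_character b x k -> has_character b x l -> k = l.
Proof.
wlog kl : k l / (k < l)%N => [hw ck cl|[f [_ fx f_cof]] cl].
  by have [/hw|/hw h|//] := ltngtP k l; [apply|rewrite h].
(* A cofinal family indexed by the smaller alphabet [k] is small for [l]. *)
exfalso; apply: (has_character_not_small cl _ fx); last first.
  by move=> y /f_cof[a Aa ya]; exists a; rewrite // dlt_asym.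
exact: small_le (small_alphabet k).
Qed.

Lemma has_character_neighbour b x k :
  has_character b x k -> exists y, y <_[b] x.
Proof.
by move=> [f [_ fx _]]; have [a /fx] := alphabet_min k; exists (f a).
Qed.

End Character.

(** * The completion and the cofinalities of words *)

Notation continuum := (order_topology (cut valid)).

Definition pt (p : word) : continuum := point_cut valid_dense p.

Lemma dlt_pt b p q : valid p -> valid q -> (pt p <_[b] pt q) = (p <_[b] q).
Proof. by move=> vp vq; case: b; exact: lt_point_cut. Qed.

Lemma pt_dense b (x y : continuum) : x <_[b] y ->
  exists2 p, valid p & (x <_[b] pt p) && (pt p <_[b] y).
Proof.
by case: b => /(point_cut_dense valid_dense)[p vp pxy]; exists p;
  rewrite // andbC.
Qed.

Lemma pt_inj p q : valid p -> valid q -> pt p = pt q -> p = q.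
Proof.
move=> vp vq e; apply/eqP; apply: contraT => /(dlt_total false)/orP[].
  by rewrite -dlt_pt // e dlt_irr.
by rewrite -dlt_pt // e dlt_irr.
Qed.

Lemma continuum_supremums (A : set continuum) : supremums A !=set0.
Proof. exact: (cut_supremums valid_dense). Qed.

Lemma continuum_dense (x y : continuum) : x < y -> exists z, x < z < y.
Proof. by move=> /(@pt_dense false)[p _ pxy]; exists (pt p). Qed.

(** Here [x] is the far end of the cylinder of [v], in the direction in which the children of [v]
    progress; so these children are cofinal on that side of [x]. *)
Lemma adjacent_character v (x : continuum) : valid v ->
  (forall t, valid (ext v t) -> pt (ext v t) <_[odd (level v)] x) ->
  (forall p, valid p -> pt p <_[odd (level v)] x ->
    extends v p \/ p <_[odd (level v)] v) ->
  has_character (odd (level v)) x (level v).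
Proof.
move=> vv vx xv; exists (fun a => pt (child v a)); split.
- move=> a b Aa Ab ab; rewrite dlt_pt; [exact: dlt_child| |]; exact/valid_child.
- by move=> a Aa; apply: vx; exact/valid_child.
move=> y /pt_dense[p vp /andP[yp px]].
suff [a Aa pa] : exists2 a, alphabet (level v) a &
    p <_[odd (level v)] child v a.
  exists a => //; apply: dlt_trans yp _; rewrite dlt_pt //; exact/valid_child.
have [a0 Aa0 _] := alphabet_min (level v).
have [/extendsP[[|a t] pE]|pv] := xv p vp px.
- by exists a0; rewrite // pE ext0; exact: dlt_self_child.
- move: vp; rewrite pE => /valid_ext[_ [Aa _]].
  by have [b [Ab ab _]] := alphabet_next Aa; exists b => //; exact: dlt_child.
- by exists a0 => //; apply: dlt_trans pv (dlt_self_child _ _ _).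
Qed.

(** The children of [p] lie on this side, and the cylinder of the first one is adjacent to [p]. *)
Lemma word_character_succ p : valid p ->
  has_character (odd (level p).+1) (pt p) (level p).+1.
Proof.
move=> vp; have [a Aa a_min] := alphabet_min (level p).
rewrite -(level_child p a); apply: adjacent_character.
- exact/valid_child.
- move=> t vt; rewrite dlt_pt // level_child /= dltN ext_child.
  exact: dlt_self_child.
move=> q vq; rewrite dlt_pt // level_child /= !dltN => pq.
have [/extendsP[[|b t] qE]|npq] := boolP (extends p q).
- by rewrite qE ext0 dlt_irr in pq.
- move: vq; rewrite qE => /valid_ext[_ [/a_min + _]].
  rewrite le_eqVlt => /orP[/eqP<-|ab]; last by right; exact: dlt_child.
  by left; rewrite -ext_child extends_ext.
- by right; rewrite dlt_extl.
Qed.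

Lemma int_word_character i : has_character false (pt (int_word i)) 0.
Proof.
apply: (@adjacent_character (int_word (i - 1))) => //.
  by move=> t vt; rewrite dlt_pt // /dlt !ltwE /=; apply/orP; left; lia.
move=> q vq; rewrite dlt_pt // /dlt !ltwE /=.
have -> : alt_lt false (trail q) [::] = false by case: (trail q).
rewrite andbF orbF => qi; have [e|ne] := eqVneq (base q) (i - 1)%R.
  by left; rewrite /extends /= e eqxx prefix0s.
by right; apply/orP; left; lia.
Qed.

(** The cylinder of the next sibling [child m b] is adjacent to [child m a] on this side, the
    extensions of [child m a] lying on the other. For an integer word, the cylinder of the preceding
    integer plays this role. *)
Lemma word_character p : valid p ->
  has_character (odd (level p)) (pt p) (level p).
Proof.
have [-> _|[m [a ->]]] := wordP p; first exact: int_word_character.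
move=> /[dup] vma /valid_child[vm Aa].
have [b [Ab ab b_min]] := alphabet_next Aa.
rewrite level_child -(level_child m b); apply: adjacent_character.
- exact/valid_child.
- move=> t vt; rewrite dlt_pt // level_child /= dltN ext_child.
  exact: dlt_child.
move=> q vq; rewrite dlt_pt // level_child /= !dltN => aq.
have [/extendsP[[|c t] qE]|nmq] := boolP (extends m q).
- by move: aq; rewrite qE dlt_ext.
- move: vq aq; rewrite qE => /valid_ext[_ [Ac _]]; rewrite dlt_ext /=.
  case: eqP => [_|_ ac]; first by case: (t).
  move: (b_min _ Ac ac).
  rewrite le_eqVlt => /orP[/eqP<-|bc]; last by right; exact: dlt_child.
  by left; rewrite -ext_child extends_ext.
- by right; move: aq; rewrite !dlt_extl.
Qed.

(** Cylinders consist of words, so a general point can only lie in the convex hull of one, strictly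
    between two of its words [u] and [w]. *)
Definition in_hull (n : nat) (x : continuum) : Prop :=
  exists v u w, [/\ valid v, level v = n, valid u /\ extends v u,
    valid w /\ extends v w & (pt u <_[odd n] x) && (x <_[odd n] pt w)].

(** * Points that are not words *)

Section Classification.
Variable x : continuum.
Hypothesis x_npt : forall p, valid p -> pt p <> x.

Lemma npt_total b p : valid p -> ~~ (x <_[b] pt p) -> pt p <_[b] x.
Proof.
move=> vp /negPf xp; have /eqP/(dlt_total b) := @x_npt _ vp.
by rewrite xp orbF.
Qed.

Lemma in_hull0 (y z : continuum) : y < x -> x < z -> in_hull 0 x.
Proof.
move=> /(@pt_dense false)[p vp /andP[_ px]].
move=> /(@pt_dense false)[q vq /andP[xq _]].
(* This is the first integer word beyond [x]. The value [n = 0] is impossible, because [p] precedes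
   [x] but not the integer word of its own base. *)
have [n n_min] : exists n : nat, x <_[false] pt (int_word (base p + n%:Z)%R) /\
    ~~ (x <_[false] pt (int_word (base p + n%:Z - 1)%R)).
  have rb : exists n : nat, x <_[false] pt (int_word (base p + n%:Z)%R).
    exists (`|(base q + 1 - base p)%R|%N); apply: dlt_trans (xq) _.
    rewrite dlt_pt // /dlt !ltwE /=; apply/orP; left.
    have : p <_[false] q by rewrite -dlt_pt // (dlt_trans px xq).
    by rewrite /dlt ltwE => /orP[|/andP[/eqP + _]]; lia.
  have [n xn n_min] := ex_minnP rb; exists n; split=> //.
  case: n xn n_min => [|n] xn n_min.
    exfalso; move: (dlt_trans px xn).
    rewrite dlt_pt // /dlt !ltwE /= addr0 ltxx eqxx.
    by case: (trail p).
  apply/negP => xn'; suff : (n < n)%N by rewrite ltnn.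
  apply: n_min; have -> // : (base p + n%:Z = base p + n.+1%:Z - 1)%R by lia.
case: n_min => xn /npt_total xn'.
have {}xn' := xn' (valid_int_word _).
have [r vr /andP[xr rn]] := pt_dense xn.
have ir : int_word (base p + n%:Z - 1)%R <_[false] r.
  by rewrite -dlt_pt // (dlt_trans xn' xr).
exists (int_word (base p + n%:Z - 1)%R), (int_word (base p + n%:Z - 1)%R), r.
split=> //; first by split=> //; exact: extends_refl.
  split=> //; rewrite /extends prefix0s andbT; apply/eqP.
  move: rn ir; rewrite dlt_pt // /dlt !ltwE /=.
  have -> : alt_lt false (trail r) [::] = false by case: (trail r).
  by rewrite andbF orbF => rn /orP[|/andP[/eqP + _]] /=; lia.
by rewrite xn' xr.
Qed.

(** Let [c] be the first letter for which [child v c] lies beyond [x]. As [x] lies in no hull of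
    level [n.+1], the whole cylinder of [child v c] lies beyond [x] and is adjacent to it. On the
    other side, [v] and its children before [c] are cofinal, but too few for an alphabet of index at
    least [n]. *)
Lemma in_hull_child n : in_hull n x -> ~ in_hull n.+1 x ->
  has_character (~~ odd n) x n.+1 /\
  forall k, (n <= k)%N -> ~ has_character (odd n) x k.
Proof.
move=> [v [u [w [vv lv [vu vEu] [vw vEw] /andP[ux xw]]]]] nhull.
rewrite -{n}lv in nhull ux xw *; set o := odd (level v) in ux xw *.
have vu_le q : u <_[o] q -> v <_[o] q.
  move: vEu => /extendsP[[|a t] ->]; first by rewrite ext0.
  by apply: dlt_trans; exact: dlt_self_child.
have vx : pt v <_[o] x.
  apply: npt_total => //; apply/negP => /(dlt_trans ux).
  rewrite dlt_pt // => /vu_le; by rewrite dlt_irr.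
have [c [[Ac xc] c_min]] : exists c,
    (alphabet (level v) c /\ x <_[o] pt (child v c)) /\
    forall e, alphabet (level v) e -> x <_[o] pt (child v e) -> c <= e.
  have [|c Cc c_min] := @letter_min
      [set c | alphabet (level v) c /\ x <_[o] pt (child v c)]; last first.
    by exists c; split=> // e Ae xe; exact: c_min.
  move: vEw => /extendsP[[|c t] wE].
    by move: (dlt_trans vx xw); rewrite dlt_pt // wE ext0 dlt_irr.
  move: (vw); rewrite wE => /valid_ext[_ [Ac _]]; exists c; split=> //.
  have vc : valid (child v c) by exact/valid_child.
  case: t wE => [wE|e t wE]; first by rewrite /child -wE.
  apply: dlt_trans xw _; rewrite dlt_pt // wE /child dlt_ext /= eqxx.
  by [].
have vc : valid (child v c) by exact/valid_child.
have x_below t : valid (ext (child v c) t) -> x <_[o] pt (ext (child v c) t).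
  move=> vct; apply: contrapT => /negP/npt_total-/(_ vct) tx; apply: nhull.
  exists (child v c), (child v c), (ext (child v c) t).
  split; rewrite ?level_child //.
  - by split=> //; exact: extends_refl.
  - by split=> //; exact: extends_ext.
  - by rewrite /= !dltN xc tx.
have below_x e : alphabet (level v) e -> e < c -> pt (child v e) <_[o] x.
  move=> Ae ec; apply: npt_total; first exact/valid_child.
  by apply/negP => /(c_min _ Ae); rewrite leNgt ec.
split.
  rewrite -(level_child v c).
  have oE : ~~ o = odd (level (child v c)) by rewrite level_child.
  rewrite oE; apply: adjacent_character => //; rewrite -oE.
    by move=> t vct; rewrite dltN; exact: x_below.
  move=> p vp; rewrite !dltN => xp.
  have [/extendsP[[|e t] pE]|nvp] := boolP (extends v p).
  - by move: (dlt_trans vx xp); rewrite pE ext0 dlt_irr.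
  - have Ae : alphabet (level v) e by move: vp; rewrite pE => /valid_ext[_ []].
    have [ec|ce|ec] := ltgtP e c.
    + have xe := below_x _ Ae ec; move: (dlt_trans xe xp).
      rewrite dlt_pt //; last exact/valid_child.
      rewrite pE /child dlt_ext /= eqxx.
      by case: (t).
    + by right; rewrite pE; exact: dlt_child.
    + by left; rewrite pE ec -ext_child extends_ext.
  - right; rewrite dlt_extl //; apply: vu_le.
    by rewrite -dlt_pt // (dlt_trans ux xp).
move=> k nk ck.
(* The index [c] stands for [v] itself, so that the family is indexed by the small initial segment
   of [c]. *)
pose g e := if e == c then pt v else pt (child v e).
have g_lt e : alphabet (level v) e /\ e <= c -> g e <_[o] x.
  rewrite /g; case: eqP => // /eqP ec [Ae ec']; apply: below_x => //.
  by rewrite lt_neqAle ec.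
apply: (has_character_not_small ck _ g_lt).
  apply: (@small_le _ _ _ _ nk); case: Ac => _; apply: small_sub.
  by move=> e [[te _] ec].
move=> y /pt_dense[p vp /andP[yp px]].
suff [e Ae ge] : exists2 e, alphabet (level v) e /\ e <= c &
    ~~ (g e <_[o] pt p).
  by exists e => //; apply: contra ge => /dlt_trans; apply.
have [/extendsP[[|e t] pE]|nvp] := boolP (extends v p).
- by exists c; rewrite ?lexx // /g eqxx pE ext0 dlt_irr.
- have Ae : alphabet (level v) e by move: vp; rewrite pE => /valid_ext[_ []].
  have [ec|ce|ec] := ltgtP e c.
  + exists e; first by rewrite ltW.
    rewrite /g lt_eqF // dlt_pt //; last exact/valid_child.
    by rewrite pE /child dlt_ext /= eqxx; case: (t).
  + exfalso; move: (dlt_trans px xc); rewrite dlt_pt // pE.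
    by rewrite dlt_asym //; exact: dlt_child.
  + exfalso; have := x_below t; rewrite -ec ext_child -pE => /(_ vp).
    by rewrite dlt_asym.
- exists c; rewrite ?lexx // /g eqxx dlt_pt //.
  move: (dlt_trans px xc); rewrite dlt_pt // dlt_extr // => pv.
  by rewrite dlt_asym.
Qed.

(** If [x] leaves the hulls at some level, the conclusions of [in_hull_child] contradict the two
    characters for either value of [b]. If it lies in hulls of all levels, their ends form a
    countable cofinal family. *)
Lemma npt_no_character b k :
  has_character b x k -> has_character (~~ b) x k.+1 -> False.
Proof.
move=> ck ck1.
have hull n : in_hull n x.
  elim: n => [|n IH].
    have [y yx] := has_character_neighbour ck.
    have [z] := has_character_neighbour ck1.
    case: b yx {ck ck1} => /= yx zx; last exact: in_hull0 yx zx.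
    exact: in_hull0 zx yx.
  apply: contrapT => /(in_hull_child IH)[cn nc].
  have [bo|bo] := eqVneq b (odd n).
    rewrite bo in ck ck1; have [kn] := has_character_inj cn ck1.
    by apply: (nc k) ck; rewrite kn.
  have {}bo := neq_negb bo.
  rewrite bo negbK in ck ck1; have kn := has_character_inj cn ck.
  by apply: (nc k.+1) ck1; rewrite -kn !leqW.
(* Between the ends of a hull of level [n] there are only words of level at least [n], so a word [p]
   is no longer there at index [(level p).+1]. *)
have /choice[z zP] : forall n, exists z, exists z',
    [/\ valid z, valid z', pt z <_[b] x, x <_[b] pt z' &
    forall p, valid p -> z <_[b] p -> p <_[b] z' -> (n <= level p)%N].
  move=> n; have [v [u [w [vv lv [vu vEu] [vw vEw] /andP[ux xw]]]]] := hull n.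
  have [bo|bo] := eqVneq b (odd n).
    exists u, w; rewrite bo; split=> // p vp up pw.
    by rewrite -lv extends_level // (extends_between vEu vEw up pw).
  have {}bo := neq_negb bo.
  exists w, u; rewrite bo !dltN; split=> // p vp; rewrite !dltN => pw up.
  by rewrite -lv extends_level // (extends_between vEu vEw up pw).
apply: (@has_character_not_small _ _ b x k nat setT (pt \o z) ck).
- exact: small_nat.
- by move=> n _ /=; have [z' []] := zP n.
move=> y /pt_dense[p vp /andP[yp px]]; exists (level p).+1 => //=.
have [z' [vz vz' zx xz' zz']] := zP (level p).+1.
apply/negP => zy; have := zz' p vp; rewrite ltnn => h.
suff : false by []; apply: h.
  by rewrite -dlt_pt // (dlt_trans zy yp).
by rewrite -dlt_pt // (dlt_trans px xz').
Qed.

End Classification.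

(** By [npt_no_character] the point is a word [p]. Exchanged sides would require both
    [k = (level p).+1] and [k.+1 = level p]. *)
Lemma word_of_characters b (x : continuum) k :
  has_character b x k -> has_character (~~ b) x k.+1 ->
  exists p, [/\ valid p, x = pt p, level p = k & b = odd k].
Proof.
move=> ck ck1.
have [[p [vp xE]]|nx] := EM (exists p, valid p /\ x = pt p); last first.
  exfalso; apply: (npt_no_character _ ck ck1) => p vp e.
  by apply: nx; exists p.
exists p; rewrite xE in ck ck1 *.
have [c0 c1] := (word_character vp, word_character_succ vp).
have [bo|bo] := eqVneq b (odd (level p)).
  by rewrite bo in ck *; rewrite (has_character_inj ck c0).
have {}bo := neq_negb bo.
rewrite bo negbK in ck ck1; have k1 := has_character_inj ck c1.
by have := has_character_inj ck1 c0; lia.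
Qed.

(** * Homeomorphisms *)

(** The bit [c] tells whether the maps reverse the order, so that increasing and decreasing
    bijections are treated together. *)
Lemma has_character_map {d d'} {T : orderType d} {U : orderType d'} (c : bool)
    (f : T -> U) (g : U -> T) b x k : cancel f g -> cancel g f ->
  (forall b x y, x <_[b] y -> f x <_[b (+) c] f y) ->
  (forall b x y, x <_[b] y -> g x <_[b (+) c] g y) ->
  has_character b x k -> has_character (b (+) c) (f x) k.
Proof.
move=> fK gK fm gm [h [h_incr hx h_cof]]; exists (f \o h); split=> /=.
- by move=> a a' Aa Aa' aa'; apply: fm; exact: h_incr.
- by move=> a Aa; apply: fm; exact: hx.
move=> y /gm; rewrite -addbA addbb addbF fK => /h_cof[a Aa ya].
by exists a => //; rewrite -(gK y); exact: fm.
Qed.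

(** * Rigidity of increasing bijections *)

Section IncreasingBijection.
Variables phi psi : continuum -> continuum.
Hypotheses (phiK : cancel phi psi) (psiK : cancel psi phi).
Hypothesis phi_lt : {homo phi : x y / x < y}.
Hypothesis psi_lt : {homo psi : x y / x < y}.

Lemma phi_dlt b x y : x <_[b] y -> phi x <_[b] phi y.
Proof. by case: b; exact: phi_lt. Qed.

Lemma phi_word p : valid p ->
  exists q, [/\ valid q, phi (pt p) = pt q & level q = level p].
Proof.
move=> vp; have psi_dlt b x y : x <_[b] y -> psi x <_[b] psi y.
  by case: b; exact: psi_lt.
have phi_ch b x k : has_character b x k -> has_character b (phi x) k.
  rewrite -{2}(addbF b); apply: (has_character_map phiK psiK).
    by move=> b' y z; rewrite addbF; exact: phi_dlt.
  by move=> b' y z; rewrite addbF; exact: psi_dlt.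
have c0 := phi_ch _ _ _ (word_character vp).
have c1 := phi_ch _ _ _ (word_character_succ vp).
by have [q [vq qE lq _]] := word_of_characters c0 c1; exists q.
Qed.

Lemma level0 p : level p = 0%N -> p = int_word (base p).
Proof. by case: p => i s /size0nil /= ->. Qed.

Lemma phi_cmp b p q r : valid p -> valid q -> valid r ->
  phi (pt p) = pt q -> phi (pt r) = pt r -> p <_[b] r -> q <_[b] r.
Proof.
by move=> vp vq vr pq rr; rewrite -!dlt_pt // => /phi_dlt; rewrite pq rr.
Qed.

Lemma not_lt_int_word p : (p <_[false] int_word (base p)) = false.
Proof. by rewrite /dlt !ltwE /= ltxx eqxx; case: (trail p). Qed.

Lemma child_inj m m' a a' : child m a = child m' a' -> m = m' /\ a = a'.
Proof.
case: m m' => [i s] [j t] [-> /=]; rewrite !cats1 => /eqP.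
by rewrite eqseq_rcons => /andP[/eqP-> /eqP->].
Qed.

(* Two words of the same length which compare in the same way with all shorter
   words differ at most by their last letter *)
Lemma phi_child m a : valid (child m a) ->
  (forall q, valid q -> (level q <= level m)%N -> phi (pt q) = pt q) ->
  exists2 a', alphabet (level m) a' & phi (pt (child m a)) = pt (child m a').
Proof.
move=> /[dup] vma /valid_child[vm Aa] fixs.
have [q [vq pq lq]] := phi_word vma; rewrite level_child in lq.
have cmp b r : valid r -> (level r <= level m)%N ->
    child m a <_[b] r -> q <_[b] r.
  by move=> vr lr; apply: phi_cmp => //; exact: fixs.
have cmp_iff b r : valid r -> (level r <= level m)%N ->
    q <_[b] r -> child m a <_[b] r.
  move=> vr lr qr; apply: contraT => npr.
  have /(dlt_total b) : child m a != r.
    by apply: contraTneq lr => <-; rewrite level_child ltnn.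
  rewrite (negPf npr) /= -(dltN b) => /(cmp _ _ vr lr).
  by rewrite dltN => /(dlt_trans qr); rewrite dlt_irr.
(* Integer words have level 0 and are fixed by assumption, so comparison with them determines the
   base. *)
have bE : base q = base m.
  have [bq|mq|//] := ltgtP (base q) (base m).
    have qm : q <_[false] int_word (base m) by rewrite /dlt ltwE /= bq.
    have := cmp_iff _ _ (valid_int_word _) (leq0n _) qm.
    by rewrite (not_lt_int_word (child m a)).
  have mq' : child m a <_[false] int_word (base q) by rewrite /dlt ltwE /= mq.
  have := cmp _ _ (valid_int_word _) (leq0n _) mq'.
  by rewrite not_lt_int_word.
suff [a' qE] : exists a', q = child m a'.
  by rewrite qE in vq pq; exists a' => //; move/valid_child: vq => [].
have [<-|] := eqVneq (child m a) q; first by exists a.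
move=> mq.
have /seq_diverge[u [s [t [sE tE st]]]] : trail (child m a) != trail q.
  apply: contra_neq mq => e; rewrite [RHS](_ : _ = Word (base q) (trail q)).
    by rewrite -e bE.
  by case: (q).
pose w := Word (base m) u.
have pE : child m a = ext w s by rewrite /ext /w /= -sE.
have qE : q = ext w t by rewrite /ext /w /= -bE -tE; case: (q).
have lst : size s = size t.
  by move: lq; rewrite -(level_child m a) pE qE !level_ext => /addnI->.
case: s t lst st pE qE {sE tE} => [|c s] [|c' t] //= [lst] cc' pE qE.
have {}cc' : c != c' by apply: contra_neq cc' => ->.
case: s t lst pE qE => [|e s] [|e' t] //= lst pE qE.
  by exists c'; rewrite qE /child; move: pE => /child_inj[-> _].
have lw : ((level w).+1 <= level m)%N.
  have := level_child m a; rewrite pE level_ext /=; lia.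
have : valid (ext w [:: c, e & s]) by rewrite -pE.
move=> /valid_ext[vw [Ac _]].
have : valid (ext w [:: c', e' & t]) by rewrite -qE.
move=> /valid_ext[_ [Ac' _]].
have wc : valid (child w c) by exact/valid_child.
have wc' : valid (child w c') by exact/valid_child.
(* The words now diverge at [w] before the last letter. In the direction of [w], [child m a]
   precedes [child w c] and [q] precedes [child w c']. Both children of [w] are short enough to be
   fixed, so the comparisons transfer and give contradictory orders of [c] and [c']. *)
have : child m a <_[odd (level w)] child w c.
  by rewrite pE /child dlt_ext /= eqxx.
move=> /(cmp _ _ wc); rewrite level_child => /(_ lw).
rewrite qE /child dlt_ext /= eq_sym (negPf cc') => c'c.
have : q <_[odd (level w)] child w c'.
  by rewrite qE /child dlt_ext /= eqxx.
move=> /(cmp_iff _ _ wc'); rewrite level_child => /(_ lw).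
rewrite pE /child dlt_ext /= (negPf cc') => cc.
by move: (lt_trans cc c'c); rewrite ltxx.
Qed.

End IncreasingBijection.

(** Induction on the level. If [child m b] is the first child of [m] that moves, its image and
    preimage are children of [m] whose letters cannot come before [b]; if both come after [b],
    monotonicity fails. *)
Lemma increasing_bijection_id (phi psi : continuum -> continuum) :
  cancel phi psi -> cancel psi phi ->
  {homo phi : x y / x < y} -> {homo psi : x y / x < y} ->
  (forall i, phi (pt (int_word i)) = pt (int_word i)) -> phi =1 id.
Proof.
move=> phiK psiK phi_lt psi_lt fix0.
have fixw n : forall p, valid p -> (level p <= n)%N -> phi (pt p) = pt p.
  elim: n => [|n IH] p vp lp.
    by rewrite (@level0 p) //; apply/eqP; rewrite -leqn0.
  have [pE|[m [a pE]]] := wordP p; first by rewrite pE.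
  have {IH}fixm q : valid q -> (level q <= level m)%N -> phi (pt q) = pt q.
    move=> vq lq; apply: IH => //; apply: leq_trans lq _.
    by rewrite pE level_child ltnS in lp.
  have fixm' q : valid q -> (level q <= level m)%N -> psi (pt q) = pt q.
    by move=> vq lq; rewrite -{1}(fixm q vq lq) phiK.
  apply: contrapT => np; rewrite {}pE in vp lp np.
  have [vm Aa] := (valid_child m a).1 vp.
  have [|{a vp lp np Aa} b [Ab nb] b_min] := @letter_min
      [set a | alphabet (level m) a /\
        phi (pt (child m a)) <> pt (child m a)]; first by exists a.
  have fixb c : alphabet (level m) c -> c < b ->
      phi (pt (child m c)) = pt (child m c).
    move=> Ac cb; apply: contrapT => nc; have := b_min c (conj Ac nc).
    by rewrite leNgt cb.
  have vb : valid (child m b) by exact/valid_child.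
  have [c Ac bc] := phi_child phiK psiK phi_lt psi_lt vb fixm.
  have [e Ae be] := phi_child psiK phiK psi_lt phi_lt vb fixm'.
  have {be}eb : phi (pt (child m e)) = pt (child m b) by rewrite -be psiK.
  have vc : valid (child m c) by exact/valid_child.
  have ve : valid (child m e) by exact/valid_child.
  have [cb|bc'|cb] := ltgtP c b.
  - by have := fixb c Ac cb; rewrite -bc => /(can_inj phiK).
  - have [eb'|be|eb'] := ltgtP e b.
    + have := fixb e Ae eb'; rewrite eb => /(pt_inj vb ve)/child_inj[_].
      by move=> be; rewrite be ltxx in eb'.
    + have : pt (child m b) <_[odd (level m)] pt (child m e).
        by rewrite dlt_pt //; exact: dlt_child.
      move=> /(phi_dlt phi_lt); rewrite bc eb dlt_pt //.
      by rewrite dlt_asym //; exact: dlt_child.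
    + by apply: nb; rewrite -{1}eb'.
  - by apply: nb; rewrite bc cb.
have fixp p : valid p -> phi (pt p) = pt p by move=> vp; exact: fixw (leqnn _).
(* A point that moves would be separated from its image by a word, which is fixed. *)
move=> x; have [//|] := eqVneq (phi x) x.
move=> /(dlt_total false)/orP[]/pt_dense[p vp /andP[h1 h2]]; exfalso.
  have := phi_dlt phi_lt h2; rewrite fixp //.
  by rewrite dlt_asym.
have := phi_dlt phi_lt h1; rewrite fixp //.
by rewrite dlt_asym.
Qed.

(** Levels are preserved, so integer words go to integer words. An increasing bijection of the
    integers commutes with the successor, hence is a translation. *)
Lemma increasing_bijection_int (phi psi : continuum -> continuum) :
  cancel phi psi -> cancel psi phi ->
  {homo phi : x y / x < y} -> {homo psi : x y / x < y} ->
  exists k : int, forall i, phi (pt (int_word i)) = pt (int_word (i + k)%R).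
Proof.
move=> phiK psiK phi_lt psi_lt.
have [/choice[g gP] /choice[g' g'P]] :
    (forall i, exists j, phi (pt (int_word i)) = pt (int_word j)) /\
    (forall i, exists j, psi (pt (int_word i)) = pt (int_word j)).
  split=> i.
    have [q [_ qE lq]] := phi_word phiK psiK phi_lt psi_lt (valid_int_word i).
    by exists (base q); rewrite qE {1}(level0 lq).
  have [q [_ qE lq]] := phi_word psiK phiK psi_lt phi_lt (valid_int_word i).
  by exists (base q); rewrite qE {1}(level0 lq).
have ltE i j : (int_word i <_[false] int_word j) = (i < j).
  by rewrite /dlt ltwE /= andbF orbF.
have g_lt i j : i < j -> g i < g j.
  rewrite -!ltE -!(@dlt_pt false) // => /(phi_dlt phi_lt).
  by rewrite !gP.
have gg' i : g (g' i) = i.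
  have : pt (int_word (g (g' i))) = pt (int_word i) by rewrite -gP -g'P psiK.
  by move=> /(pt_inj (valid_int_word _) (valid_int_word _)) [].
have gS i : g (i + 1)%R = (g i + 1)%R.
  have gi : g i < g (i + 1)%R by apply: g_lt; lia.
  have [ij|ji|ij] := ltgtP i (g' (g i + 1)%R).
  - have := gg' (g i + 1)%R.
    have : g (i + 1)%R <= g (g' (g i + 1)%R).
      have : (i + 1)%R <= g' (g i + 1)%R by lia.
      by rewrite le_eqVlt => /orP[/eqP->|/g_lt/ltW].
    by lia.
  - by have := g_lt _ _ ji; rewrite gg'; lia.
  - by have := gg' (g i + 1)%R; rewrite -ij; lia.
exists (g 0) => i; rewrite gP; congr (pt (int_word _)).
elim: i => [|n IH|n IH]; first by rewrite add0r.
  have -> : (n.+1%:Z = n%:Z + 1)%R by lia.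
  by rewrite gS IH; lia.
have := gS (- n.+1%:Z)%R.
have -> : (- n.+1%:Z + 1 = - n%:Z)%R by lia.
by rewrite IH; lia.
Qed.

(** * Translations *)

Definition shift (k : int) (p : word) : word := Word (base p + k)%R (trail p).

Lemma shiftK k : cancel (shift k) (shift (- k)%R).
Proof. by case=> i s; rewrite /shift /= addrK. Qed.

Lemma shiftNK k : cancel (shift (- k)%R) (shift k).
Proof. by case=> i s; rewrite /shift /= subrK. Qed.

Lemma shift_lt k : {homo shift k : p q / p < q}.
Proof.
move=> p q; rewrite !ltwE /= => /orP[pq|/andP[/eqP -> ->]].
  by apply/orP; left; lia.
by rewrite eqxx orbT.
Qed.

Lemma valid_shift k p : valid p -> valid (shift k p).
Proof. by []. Qed.

Definition translation (k : int) : continuum -> continuum :=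
  map_cut (shiftK k) (shiftNK k) (@valid_shift k) (@valid_shift (- k)%R)
    (@shift_lt k) (@shift_lt (- k)%R).

Lemma translation_pt k p : valid p -> translation k (pt p) = pt (shift k p).
Proof. exact: (map_cut_point valid_dense). Qed.

Lemma translationK k : cancel (translation k) (translation (- k)%R).
Proof.
by move=> x; apply: cut_ext; apply/seteqP; split=> p /=; rewrite opprK shiftK.
Qed.

Lemma translationD k l x :
  translation (k + l)%R x = translation k (translation l x).
Proof.
apply: cut_ext; apply/seteqP; split=> p /=; rewrite /shift /=.
  by rewrite -addrA -opprD.
by rewrite -addrA -opprD.
Qed.

Lemma translationNK k : cancel (translation (- k)%R) (translation k).
Proof. by move=> x; rewrite -{1}(opprK k) translationK. Qed.

Lemma translation_lt k : {homo translation k : x y / x < y}.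
Proof.
move=> x y xy; rewrite lt_neqAle; apply/andP; split.
  by apply: contraTneq xy => /(can_inj (translationK k))->; rewrite ltxx.
by apply: map_cut_homo; exact: ltW.
Qed.

Lemma homeomorphism_translation k : homeomorphism (translation k).
Proof.
split.
  exact: increasing_continuous (@translation_lt _) (@translation_lt _)
    (translationNK k).
exists (translation (- k)%R).
split; [|exact: translationK|exact: translationNK].
exact: increasing_continuous (@translation_lt _) (@translation_lt _)
  (translationK k).
Qed.

(** * The homeomorphisms of the completion *)

Lemma continuum_compact : compact [set: continuum].
Proof. exact: complete_compact continuum_supremums. Qed.

Lemma continuum_connected : connected [set: continuum].
Proof. exact: complete_connected continuum_supremums continuum_dense. Qed.

(** The word of the integer 0 has characters 0 on the left and 1 on the right. Its image would have
    them exchanged, and [word_of_characters] would make [odd 0] true. *)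
Lemma no_decreasing_bijection (phi psi : continuum -> continuum) :
  cancel phi psi -> cancel psi phi ->
  {homo phi : x y / x < y >-> y < x} -> {homo psi : x y / x < y >-> y < x} ->
  False.
Proof.
move=> phiK psiK phi_gt psi_gt.
have phi_ch b x k : has_character b x k -> has_character (~~ b) (phi x) k.
  rewrite -addbT; apply: (has_character_map phiK psiK).
    by move=> [] y z; [exact: phi_gt|exact: phi_gt].
  by move=> [] y z; [exact: psi_gt|exact: psi_gt].
have c0 := phi_ch _ _ _ (word_character (valid_int_word 0)).
have c1 := phi_ch _ _ _ (word_character_succ (valid_int_word 0)).
by have [q [_ _ _]] := word_of_characters c0 c1.
Qed.

Lemma inverse_increasing {d} {T : orderType d} (phi psi : T -> T) :
  cancel phi psi -> cancel psi phi ->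
  {homo phi : x y / x < y} -> {homo psi : x y / x < y}.
Proof.
move=> phiK psiK phi_lt x y xy; have [//|yx|e] := ltgtP (psi x) (psi y).
  by move: (phi_lt _ _ yx); rewrite !psiK ltNge (ltW xy).
by move: xy; rewrite -(psiK x) e psiK ltxx.
Qed.

Lemma inverse_decreasing {d} {T : orderType d} (phi psi : T -> T) :
  cancel phi psi -> cancel psi phi ->
  {homo phi : x y / x < y >-> y < x} -> {homo psi : x y / x < y >-> y < x}.
Proof.
move=> phiK psiK phi_gt x y xy; have [yx|//|e] := ltgtP (psi x) (psi y).
  by move: (phi_gt _ _ yx); rewrite !psiK ltNge (ltW xy).
by move: xy; rewrite -(psiK x) e psiK ltxx.
Qed.

Lemma homeo_increasing (h : homeo continuum) : {homo h : x y / x < y}.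
Proof.
have [ch [psi [_ hK psiK]]] := homeoP h.
have [//|h_gt] := injective_continuous_monotone continuum_supremums
  continuum_dense ch (can_inj hK).
have psi_gt := inverse_decreasing hK psiK h_gt.
by case: (no_decreasing_bijection hK psiK h_gt psi_gt).
Qed.

Lemma homeo_translation (h : homeo continuum) : exists k, h =1 translation k.
Proof.
have [ch [psi [_ hK psiK]]] := homeoP h.
have h_lt := @homeo_increasing h.
have psi_lt := inverse_increasing hK psiK h_lt.
have [k hk] := increasing_bijection_int hK psiK h_lt psi_lt.
exists k => x.
have /(_ x) : translation (- k)%R \o h =1 id; last first.
  by move=> /= e; rewrite -{2}e translationNK.
apply: (@increasing_bijection_id _ (psi \o translation k)).
- by move=> y /=; rewrite translationNK hK.
- by move=> y /=; rewrite psiK translationK.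
- by move=> y z yz /=; apply: translation_lt; exact: h_lt.
- by move=> y z yz /=; apply: psi_lt; exact: translation_lt.
- by move=> i /=; rewrite hk translation_pt // /shift /= addrK.
Qed.

Lemma translation_inj k l : translation k =1 translation l -> k = l.
Proof.
move=> /(_ (pt (int_word 0))); rewrite !translation_pt // => /pt_inj.
by move=> /(_ (valid_int_word _) (valid_int_word _)) []; rewrite !add0r.
Qed.

Definition translation_homeo (k : discrete_int) : homeo continuum :=
  mk_homeo (homeomorphism_translation k).

Definition translation_number (h : homeo continuum) : discrete_int :=
  projT1 (cid (homeo_translation h)).

Lemma translation_numberP (h : homeo continuum) :
  h =1 translation (translation_number h).
Proof. exact: (projT2 (cid (homeo_translation h))). Qed.

Lemma translation_homeoK : cancel translation_homeo translation_number.
Proof.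
by move=> k; apply: translation_inj => x; rewrite -translation_numberP.
Qed.

Lemma translation_numberK : cancel translation_number translation_homeo.
Proof. by move=> h; apply: homeo_ext => x; exact/esym/translation_numberP. Qed.

(** The homeomorphisms that send the word of 0 strictly between those of [k - 1] and [k + 1] form a
    neighbourhood of [h], and each of them is the translation by [k]. *)
Lemma translation_number_continuous : continuous translation_number.
Proof.
move=> h U /= /nbhs_singleton Uh.
set k := translation_number h in Uh.
pose O := `]pt (int_word (k - 1)%R), pt (int_word (k + 1)%R)[%classic.
have hO l : O (translation l (pt (int_word 0))) <-> l = k.
  rewrite translation_pt // /O /= in_itv /=.
  have /= E i j : (pt (int_word i) < pt (int_word j)) = (i < j).
    rewrite -[LHS]/(pt _ <_[false] pt _) dlt_pt // /dlt ltwE /=.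
    by rewrite andbF orbF.
  by rewrite /shift /= !E; lia.
have hP := translation_numberP h.
have : nbhs h [set l : homeo continuum | l @` [set pt (int_word 0)] `<=` O].
  apply: homeo_nbhs; [exact: compact_set1|exact: itv_open|].
  by rewrite image_set1 sub1set inE hP; exact/hO.
apply: filterS => l /=; rewrite image_set1 sub1set inE translation_numberP.
by move=> /hO ->.
Qed.

Lemma translation_number_mul :
  {morph translation_number : h l / (h * l)%g >-> (h * l)%g}.
Proof.
move=> h l; apply: translation_inj => x.
rewrite -translation_numberP discrete_intM translationD.
by rewrite -!translation_numberP.
Qed.

Theorem proposition4p2 :
  exists (d : Order.disp_t) (X : orderTopologicalType d),
    [/\ compact [set: X],
        connected [set: X],
        homeo_plus X = [set: homeo X] &
        topological_group_isomorphic (homeo X) discrete_int].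
Proof.
exists Order.default_display, continuum; split.
- exact: continuum_compact.
- exact: continuum_connected.
- apply/seteqP; split=> // h _; exact/ltW_homo/homeo_increasing.
exists translation_number; split; last exact: translation_number_mul.
split; first exact: translation_number_continuous.
exists translation_homeo; split.
(* The singleton of [k] is a neighbourhood, so continuity here holds for any topology on the group
   of homeomorphisms. *)
- move=> k U /= /nbhs_singleton Uk.
  suff : nbhs k (translation_homeo @^-1` U) by [].
  have := discrete_set1 k; apply: (@filterS _ _ (nbhs_filter k)).
  by move=> _ ->.
- exact: translation_numberK.
- exact: translation_homeoK.
Qed.
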